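(* Let $K\ge1$, let $p\ge1$ be an integer, and let $F$ be a $K$-quasiregular polyharmonic mapping in $\mathbb{D}$ of the form $$F(z)=a_0+\sum_{k=1}^p|z|^{2(k-1)}\sum_{n=1}^\infty\left(a_{n,k}z^n+\overline{b_{n,k}z^n}\right),$$ such that, for every $n\ge1$ and all $k_1,k_2,k_3,k_4\in\{1,\dots,p\}$, all non-zero coefficients $a_{n,k_1},a_{n,k_2}$ and $b_{n,k_3},b_{n,k_4}$ satisfy $$\left|\arg\frac{a_{n,k_1}}{a_{n,k_2}}\right|\le\frac{\pi}{2}\quad\text{and}\quad\left|\arg\frac{b_{n,k_3}}{b_{n,k_4}}\right|\le\frac{\pi}{2}.$$ Suppose $\lambda_F(z)\le\lambda$ for all $z\in\mathbb{D}$, where $\lambda$ is a constant, and $F(0)=0$, $J_F(0)=1$. Then $$|a_{n,k}|+|b_{n,k}|\le\frac{\sqrt{(K^2+1)\lambda^2-1/K}}{n}\quad\text{for all } n\ge2,\ k=1,$$ $$|a_{n,k}|+|b_{n,k}|\le\frac{\sqrt{(K^2+1)\lambda^2-1/K}}{\sqrt{10}}\quad\text{for all } n\ge2,\ 2\le k\le p,$$ $$|a_{n,k}|+|b_{n,k}|\le\frac{\sqrt{(K^2+1)\lambda^2-1/K}}{\sqrt{5}}\quad\text{for } n=1,\ 2\le k\le p.$$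
   Context: $\mathbb{D}=\{z\in\mathbb{C}:|z|<1\}$. For a continuously differentiable complex-valued $f$ put $\Lambda_f(z)=|f_z(z)|+|f_{\bar z}(z)|$, $\lambda_f(z)=\big||f_z(z)|-|f_{\bar z}(z)|\big|$, $J_f(z)=|f_z(z)|^2-|f_{\bar z}(z)|^2$. A $2p$-times continuously differentiable complex-valued $F$ is polyharmonic if $\Delta^pF=0$, where $\Delta=4\partial^2/\partial z\partial\bar z$. In $\mathbb{D}$ this is equivalent to $F(z)=\sum_{k=1}^p|z|^{2(k-1)}G_{p-k+1}(z)$ with all $G_{p-k+1}$ complex-valued harmonic in $\mathbb{D}$. In the series representation in the claim, for each $k$ the functions $\sum_{n\ge1}a_{n,k}z^n$ and $\sum_{n\ge1}b_{n,k}z^n$ are analytic in $\mathbb{D}$. A $K$-quasiregular mapping ($K\ge1$) is a sense-preserving continuous mapping $f:\mathbb{D}\to\mathbb{C}$ that is $ACL^2$ (absolutely continuous on almost every horizontal and vertical line in each closed rectangle in $\mathbb{D}$ with sides parallel to the axes, with locally $L^2$ partial derivatives), with $J_f\ne0$ a.e. and $\Lambda_f^2\le KJ_f$ a.e. in $\mathbb{D}$. (For a continuously differentiable $f$, which is automatically $ACL^2$, sense-preserving is taken to mean $J_f\ge0$, so that $J_f>0$ a.e.; the inequality is then equivalent to $\Lambda_f\le K\lambda_f$.) $\arg$ denotes the principal argument, in $(-\pi,\pi]$. *)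

(* Defs.v *)
From HB Require Import structures.
From mathcomp Require Import all_boot all_order all_algebra.
From mathcomp Require Import complex.
From mathcomp Require Import all_classical all_reals all_analysis.

Set Implicit Arguments.
Unset Strict Implicit.
Unset Printing Implicit Defensive.

Import Order.TTheory GRing.Theory Num.Theory.
Import numFieldNormedType.Exports.
Import ComplexField.Normc.

Local Open Scope classical_set_scope.
Local Open Scope ring_scope.

(* MathComp-Analysis attaches a topology to every numClosedFieldType, but
   canonical structure inference does not find it on the bare type [R[i]]. *)
Definition Cplx (R : realType) : numClosedFieldType := R[i].

Section Defs.
Variable R : realType.
Local Notation C := (Cplx R).
Implicit Types (f g : C -> C) (z c : C).

Definition mkC (x y : R) : C := (x +i* y)%C.

(* The modulus as an element of [R]; by contrast the norm [`|z|] has type [C]. *)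
Definition modulus z : R := normc z.

(* The principal argument, in ]-pi, pi]; see [pargP]. The value at 0 is
   irrelevant. *)
Definition parg z : R :=
  let t := acos (complex.Re z / modulus z) in
  if 0 <= complex.Im z then t else - t.

Definition unit_disc : set C := [set z | `|z| < 1].

Definition derivableC (g : R -> C) (t : R) : Prop :=
  derivable (fun s : R => complex.Re (g s)) t 1 /\
  derivable (fun s : R => complex.Im (g s)) t 1.

Definition derivC (g : R -> C) (t : R) : C :=
  mkC (derive1 (fun s : R => complex.Re (g s)) t)
      (derive1 (fun s : R => complex.Im (g s)) t).

Definition dx f z : C :=
  derivC (fun s => f (mkC s (complex.Im z))) (complex.Re z).
Definition dy f z : C :=
  derivC (fun s => f (mkC (complex.Re z) s)) (complex.Im z).

Definition partially_derivable f z : Prop :=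
  derivableC (fun s => f (mkC s (complex.Im z))) (complex.Re z) /\
  derivableC (fun s => f (mkC (complex.Re z) s)) (complex.Im z).

Definition dz f z : C := 2^-1 * (dx f z - mkC 0 1 * dy f z).
Definition dzbar f z : C := 2^-1 * (dx f z + mkC 0 1 * dy f z).

Definition Lambda f z : R := modulus (dz f z) + modulus (dzbar f z).
Definition lambda f z : R := `|modulus (dz f z) - modulus (dzbar f z)|.
Definition Jac f z : R := modulus (dz f z) ^+ 2 - modulus (dzbar f z) ^+ 2.

(* [m] times continuously differentiable (in the real sense) in the disc. *)
Fixpoint Cm_on_disc (m : nat) f : Prop :=
  {in unit_disc, continuous f} /\
  if m is m'.+1 then
    [/\ forall z, unit_disc z -> partially_derivable f z,
        Cm_on_disc m' (dx f) & Cm_on_disc m' (dy f)]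
  else True.

Definition laplacian f : C -> C := fun z => 4 * dz (dzbar f) z.

Definition polyharmonic (p : nat) f : Prop :=
  Cm_on_disc (2 * p) f /\
  forall z, unit_disc z -> iter p laplacian f z = 0.

Definition absolutely_continuous_on (s t : R) (g : R -> C) : Prop :=
  forall e : R, 0 < e -> exists2 d : R, 0 < d &
    forall (n : nat) (l r : 'I_n -> R),
      (forall i, [/\ s <= l i, l i <= r i & r i <= t]) ->
      trivIset setT (fun i => `]l i, r i[%classic) ->
      \sum_i (r i - l i) < d ->
      \sum_i modulus (g (r i) - g (l i)) < e.

(* Planar Lebesgue measure, in the coordinates (x, y). *)
Definition plane : measurableType _ :=
  (measurableTypeR R * measurableTypeR R)%type.
Definition area : set plane -> \bar R :=
  (@lebesgue_measure R \x @lebesgue_measure R)%E.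

Definition L2_on (E : set C) g : Prop :=
  let E' := [set w : plane | E (mkC w.1 w.2)] in
  (fun w : plane => complex.Re (g (mkC w.1 w.2))) \_ E' \in Lfun area 2%:E /\
  (fun w : plane => complex.Im (g (mkC w.1 w.2))) \_ E' \in Lfun area 2%:E.

Definition locally_L2 g : Prop :=
  forall E : set C, compact E -> E `<=` unit_disc -> L2_on E g.

Definition ACL f : Prop :=
  forall s t u v : R, s < t -> u < v ->
    (forall x y, s <= x <= t -> u <= y <= v -> unit_disc (mkC x y)) ->
    {ae @lebesgue_measure R, forall y : measurableTypeR R, u <= y <= v ->
       absolutely_continuous_on s t (fun x => f (mkC x y))} /\
    {ae @lebesgue_measure R, forall x : measurableTypeR R, s <= x <= t ->
       absolutely_continuous_on u v (fun y => f (mkC x y))}.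

Definition ACL2 f : Prop := [/\ ACL f, locally_L2 (dx f) & locally_L2 (dy f)].

(* The notion for continuously differentiable maps, the only ones to which it
   is applied. *)
Definition sense_preserving f : Prop := forall z, unit_disc z -> 0 <= Jac f z.

Definition quasiregular (K : R) f : Prop :=
  [/\ sense_preserving f,
      {in unit_disc, continuous f},
      ACL2 f,
      {ae area, forall w : plane, unit_disc (mkC w.1 w.2) ->
         Jac f (mkC w.1 w.2) != 0} &
      {ae area, forall w : plane, unit_disc (mkC w.1 w.2) ->
         Lambda f (mkC w.1 w.2) ^+ 2 <= K * Jac f (mkC w.1 w.2)}].

(* The power series [sum_(n >= 1) c_n z^n] defines an analytic function in the
   disc. *)
Definition analytic_series (c : nat -> C) : Prop :=
  forall z, unit_disc z -> cvgn (fun N => \sum_(1 <= n < N) c n * z ^+ n).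

Definition polyharmonic_series (p : nat) (a0 : C) (a b : nat -> nat -> C) f :
    Prop :=
  (forall k, (1 <= k <= p)%N ->
     analytic_series (a ^~ k) /\ analytic_series (b ^~ k)) /\
  (forall z, unit_disc z ->
     f z = a0 + \sum_(1 <= k < p.+1) `|z| ^+ (2 * (k - 1)) *
       limn (fun N => \sum_(1 <= n < N) (a n k * z ^+ n + (b n k * z ^+ n)^*))).

Lemma pargP z : z != 0 ->
  (- pi < parg z <= pi) /\
  z = mkC (modulus z * cos (parg z)) (modulus z * sin (parg z)).
Proof.
case: z => x y z0.
set r := modulus _.
have r2 : r ^+ 2 = x ^+ 2 + y ^+ 2.
  by rewrite /r /modulus /= sqr_sqrtr // addr_ge0 // sqr_ge0.
have r0 : 0 < r.
  rewrite lt_def sqrtr_ge0 andbT; apply: contra z0 => /eqP/eq0_normc ->.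
  exact/eqP.
have rn0 : r != 0 by rewrite gt_eqF.
have xr : -1 <= x / r <= 1.
  rewrite -ler_norml normrM normfV (gtr0_norm r0) ler_pdivrMr // mul1r.
  rewrite -(gtr0_norm r0) -ler_sqr ?nnegrE // !real_normK ?num_real // r2.
  by rewrite lerDl sqr_ge0.
have [xr1 xr2] := andP xr.
have sinE : sin (acos (x / r)) = `|y| / r.
  rewrite sin_acos //.
  have -> : 1 - (x / r) ^+ 2 = (y / r) ^+ 2.
    apply/eqP; rewrite subr_eq !expr_div_n -mulrDl addrC -r2 divff //.
    by rewrite expf_neq0.
  by rewrite sqrtr_sqr normrM normfV (gtr0_norm r0).
rewrite /parg -/r /=; case: ifPn => y0.
  split.
    rewrite acos_lepi // andbT (@lt_le_trans _ _ 0) ?acos_ge0 //.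
    by rewrite oppr_lt0 pi_gt0.
  rewrite acosK ?in_itv //= sinE (ger0_norm y0).
  by rewrite !(mulrC r) !divfK.
have y1 : y < 0 by rewrite ltNge.
split.
  rewrite ltrN2; apply/andP; split.
    apply: acos_ltpi; rewrite xr2 andbT lt_neqAle xr1 andbT eq_sym.
    apply/negP => /eqP h; move: sinE; rewrite h acosN1 sinpi => /esym/eqP.
    by rewrite mulf_eq0 normr_eq0 invr_eq0 (negbTE rn0) orbF lt_eqF.
  by rewrite (@le_trans _ _ 0) ?pi_ge0 // oppr_le0 acos_ge0.
rewrite cosN sinN acosK ?in_itv //= sinE (ltr0_norm y1).
by rewrite mulrN mulNr mulrN opprK !(mulrC r) !divfK.
Qed.

End Defs.

(* Main.v *)
(* Parseval on the circle |z| = r, applied to z F_z and conj(z) F_zbar.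

   Quasiregularity gives Lambda_F <= K lambda_F, hence
   |F_z|^2 + |F_zbar|^2 = (Lambda_F^2 + lambda_F^2)/2 <= (K^2 + 1) lam^2 / 2
   almost everywhere, and everywhere by continuity. On |z| = r the coefficient of
   z^n in z F_z is r^n sum_k (n+k-1) a_{n,k} r^{2(k-1)}, and in conj(z) F_zbar it is
   r^n sum_k (k-1) a_{n,k} r^{2(k-1)}, similarly for conj(z)^n and the b_{n,k}. The
   condition on the arguments says that the a_{n,k}, k = 1..p, have pairwise
   nonnegative real inner products, so the square of such a sum dominates the sum
   of the squares. Letting r tend to 1,
     sum_{n,k} ((n+k-1)^2 + (k-1)^2) (|a_{n,k}|^2 + |b_{n,k}|^2) <= (K^2 + 1) lam^2 / 2.
   The term (1,1) is at least 1 because J_F(0) = |a_{1,1}|^2 - |b_{1,1}|^2, which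
   leaves (K^2 + 1) lam^2 / 2 - 1 for any other term. *)
Require Import Defs.
From mathcomp Require Import all_boot all_order all_algebra.
From mathcomp Require Import all_classical all_reals all_analysis.
Import Order.TTheory GRing.Theory Num.Theory.
From mathcomp Require Import complex cyclic separable cyclotomic ring lra zify.
Import numFieldNormedType.Exports.
Local Open Scope classical_set_scope.
Local Open Scope ring_scope.
Set Implicit Arguments.
Unset Strict Implicit.
Unset Printing Implicit Defensive.

(** * The real-valued modulus and its relation to the [C]-valued norm *)

Section Modulus.
Variable R : realType.
Local Notation C := (Cplx R).
Implicit Types z w : C.

Lemma normE z : `|z| = (modulus z)%:C%C :> R[i].
Proof. by []. Qed.

Lemma modulusM z w : modulus (z * w) = modulus z * modulus w.
Proof. exact: ComplexField.Normc.normcM. Qed.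

Lemma modulusD z w : modulus (z + w) <= modulus z + modulus w.
Proof. exact: le_normcD. Qed.

Lemma modulusN z : modulus (- z) = modulus z.
Proof. exact: normcN. Qed.

Lemma modulusB z w : modulus (z - w) <= modulus z + modulus w.
Proof. by rewrite -(modulusN w) modulusD. Qed.

Lemma modulus_ge0 z : 0 <= modulus z.
Proof. by case: z => x y; exact: sqrtr_ge0. Qed.

Lemma modulus0 : modulus (0 : C) = 0.
Proof. exact: ComplexField.Normc.normc0. Qed.

Lemma modulus1 : modulus (1 : C) = 1.
Proof. exact: ComplexField.Normc.normc1. Qed.

Lemma modulus_eq0 z : (modulus z == 0) = (z == 0).
Proof.
apply/eqP/eqP => [|->]; last exact: modulus0.
exact: ComplexField.Normc.eq0_normc.
Qed.

Lemma modulusX z n : modulus (z ^+ n) = modulus z ^+ n.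
Proof.
elim: n => [|n IH]; first by rewrite !expr0 modulus1.
by rewrite !exprS modulusM IH.
Qed.

Lemma conjCE z : z^* = (conjc z : C).
Proof. by []. Qed.

Lemma ReD z w : complex.Re (z + w) = complex.Re z + complex.Re w.
Proof. by case: z w => ? ? []. Qed.

Lemma ImD z w : complex.Im (z + w) = complex.Im z + complex.Im w.
Proof. by case: z w => ? ? []. Qed.

Lemma ReB z w : complex.Re (z - w) = complex.Re z - complex.Re w.
Proof. by case: z w => ? ? []. Qed.

Lemma ImB z w : complex.Im (z - w) = complex.Im z - complex.Im w.
Proof. by case: z w => ? ? []. Qed.

Lemma ReM z w :
  complex.Re (z * w) = complex.Re z * complex.Re w - complex.Im z * complex.Im w.
Proof. by case: z w => ? ? []. Qed.

Lemma ImM z w :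
  complex.Im (z * w) = complex.Re z * complex.Im w + complex.Im z * complex.Re w.
Proof. by case: z w => ? ? []. Qed.

Lemma sqr_modulus z : modulus z ^+ 2 = complex.Re z ^+ 2 + complex.Im z ^+ 2.
Proof. by case: z => x y; rewrite /modulus /= sqr_sqrtr// addr_ge0// sqr_ge0. Qed.

Lemma modulus_conj z : modulus z^* = modulus z.
Proof. by case: z => x y; rewrite conjCE /modulus /= sqrrN. Qed.

Lemma modulus_real (x : R) : modulus (x%:C%C : C) = `|x|.
Proof. by rewrite /modulus /= expr0n addr0 sqrtr_sqr. Qed.

Lemma modulus_nat n : modulus (n%:R : C) = n%:R.
Proof.
by rewrite -[RHS](normr_nat R) -modulus_real; congr modulus; rewrite rmorph_nat.
Qed.

Lemma Re_le_modulus z : `|complex.Re z| <= modulus z.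
Proof.
rewrite -(ler_pXn2r (n := 2)) ?nnegrE ?modulus_ge0 //.
by rewrite sqr_modulus real_normK ?num_real // lerDl sqr_ge0.
Qed.

Lemma Im_le_modulus z : `|complex.Im z| <= modulus z.
Proof.
rewrite -(ler_pXn2r (n := 2)) ?nnegrE ?modulus_ge0 //.
by rewrite sqr_modulus real_normK ?num_real // lerDr sqr_ge0.
Qed.

Lemma modulus_le_ReIm z :
  modulus z <= `|complex.Re z| + `|complex.Im z|.
Proof.
rewrite -(ler_pXn2r (n := 2)) ?nnegrE ?modulus_ge0 ?addr_ge0 //.
rewrite sqr_modulus sqrrD !real_normK ?num_real // lerD2r lerDl.
by rewrite mulrn_wge0 // mulr_ge0.
Qed.

Lemma modulus_sum I (r : seq I) (P : pred I) (f : I -> C) :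
  modulus (\sum_(i <- r | P i) f i) <= \sum_(i <- r | P i) modulus (f i).
Proof.
elim/big_ind2 : _ => [|z x w y zx wy|//]; first by rewrite modulus0.
by rewrite (le_trans (modulusD _ _)) // lerD.
Qed.

Lemma unit_discE z : unit_disc z <-> modulus z < 1.
Proof. by rewrite /unit_disc /= normE; split; rewrite -ltcR. Qed.

Lemma modulus_i : modulus (mkC 0 1 : C) = 1.
Proof. by rewrite /modulus /= expr0n add0r expr1n sqrtr1. Qed.

Lemma modulus_le_dist z w (e : R) : modulus (z - w) <= e -> modulus w <= modulus z + e.
Proof. by move=> h; rewrite -[w](subKr z) (le_trans (modulusB _ _)) // lerD. Qed.

Lemma mul_conj z : z * z^* = ((modulus z ^+ 2)%:C%C : C).
Proof.
rewrite sqr_modulus; case: z => x y; rewrite conjCE.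
by apply/eqP; rewrite eq_complex /=; apply/andP; split; apply/eqP; ring.
Qed.

Lemma conj_unit z : modulus z = 1 -> z^* = z^-1.
Proof.
move=> z1; have z0 : z != 0 by rewrite -modulus_eq0 z1 oner_eq0.
by apply: (mulfI z0); rewrite mul_conj z1 expr1n divff.
Qed.

Lemma modulus_prim_root n z : (0 < n)%N -> n.-primitive_root z -> modulus z = 1.
Proof.
move=> n0 zn; have : modulus z ^+ n = 1.
  by rewrite -modulusX (prim_expr_order zn) modulus1.
by move/eqP; rewrite pexpr_eq1 ?modulus_ge0 // => /eqP.
Qed.

End Modulus.

(** * Roots of unity and a discrete Parseval identity *)

Lemma prim_root_exists (F : numClosedFieldType) n :
  (0 < n)%N -> exists z : F, n.-primitive_root z.
Proof.
move=> n0; pose p : {poly F} := 'X^n - 1.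
have [r Dp] := closed_field_poly_normal p.
rewrite (monicP _) ?monicXnsubC // scale1r in Dp.
have rn1 : all n.-unity_root r by apply/allP => z; rewrite -root_prod_XsubC -Dp.
(* [X^n - 1] splits into [n] linear factors and is separable, so [r] lists [n] distinct [n]-th roots
   of unity; among these [has_prim_root] finds a primitive one. *)
have sz_r : (n < (size r).+1)%N.
  by rewrite -(size_prod_XsubC r id) -Dp size_XnsubC.
have [|z] := hasP (has_prim_root n0 rn1 _ sz_r); last by exists z.
by rewrite -separable_prod_XsubC -Dp cyclotomic.separable_Xn_sub_1 // pnatr_eq0 -lt0n.
Qed.

Lemma sum_unity_root_powers (F : fieldType) (u : F) N :
  u ^+ N = 1 -> u != 1 -> \sum_(j < N) u ^+ j = 0.
Proof.
move=> uN u1; apply: (mulfI (x := u - 1)); first by rewrite subr_eq0.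
by rewrite -subrX1 uN subrr mulr0.
Qed.

Section Parseval.
Variable R : realType.
Local Notation C := (Cplx R).

(** Orthogonality of characters: after expanding the square, the pair [(i, k)] carries the sum over
    [j] of [(u i / u k)^j]. This is [N] on the diagonal, and vanishes off it because [u i / u k] is
    then an [N]-th root of unity other than 1. *)
Lemma discrete_parseval (I : finType) (N : nat) (u c : I -> C) :
  injective u -> (forall i, u i ^+ N = 1) -> (forall i, modulus (u i) = 1) ->
  \sum_(j < N) modulus (\sum_i c i * u i ^+ j) ^+ 2 =
  N%:R * \sum_i modulus (c i) ^+ 2.
Proof.
move=> inju uN u1.
apply: (@complexI R); rewrite rmorphM rmorph_nat !rmorph_sum /=.
transitivity (\sum_(j < N) \sum_i \sum_k
     (c i * (c k)^*) * (u i / u k) ^+ j).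
  apply: eq_bigr => j _; rewrite -mul_conj rmorph_sum /= mulr_suml.
  apply: eq_bigr => i _; rewrite mulr_sumr; apply: eq_bigr => k _.
  by rewrite rmorphM rmorphXn /= (conj_unit (u1 k)) expr_div_n exprVn; ring.
rewrite exchange_big mulr_sumr; apply: eq_bigr => i _ /=.
rewrite exchange_big (bigD1 i) //= [X in _ + X]big1 ?addr0 => [|k ki].
  rewrite (eq_bigr (fun=> c i * (c i)^*)) => [|j _]; last first.
    by rewrite divff ?expr1n ?mulr1 // -modulus_eq0 u1 oner_eq0.
  by rewrite sumr_const card_ord mul_conj mulr_natl.
rewrite -mulr_sumr sum_unity_root_powers ?mulr0 //.
  by rewrite expr_div_n !uN divr1.
apply: contra ki => /eqP uik; apply/eqP/inju.
have ukn0 : u k != 0 by rewrite -modulus_eq0 u1 oner_eq0.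
by apply/esym; rewrite -[LHS](divfK ukn0) uik mul1r.
Qed.

(* [conj w = w^-1], so [z^n] and [conj z^n] at [z = r w^j] are the powers
   [w^(jn)] and [w^(j(2m+1-n))], with distinct exponents modulo [2m+1]. *)
Lemma trig_parseval_eq (m : nat) (r : R) (w : C) (f g : nat -> C) :
  0 <= r -> (m.*2.+1).-primitive_root w ->
  \sum_(j < m.*2.+1)
     modulus (\sum_(1 <= n < m.+1) (f n * (r%:C%C * w ^+ j) ^+ n +
                                    g n * (r%:C%C * w ^+ j)^* ^+ n)) ^+ 2 =
  m.*2.+1%:R *
  \sum_(1 <= n < m.+1) (modulus (f n) ^+ 2 + modulus (g n) ^+ 2) * r ^+ (2 * n).
Proof.
move=> r0 wN; set N := m.*2.+1.
have w1 : modulus w = 1 by exact: modulus_prim_root wN.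
pose e (i : 'I_m + 'I_m) := match i with inl i => i.+1 | inr i => (N - i.+1)%N end.
pose u i := w ^+ e i.
pose c (i : 'I_m + 'I_m) := match i with
  inl i => f i.+1 * (r%:C%C : C) ^+ i.+1 | inr i => g i.+1 * (r%:C%C : C) ^+ i.+1 end.
have := @discrete_parseval _ N u c.
rewrite (_ : \sum_i modulus (c i) ^+ 2 =
  \sum_(1 <= n < m.+1) (modulus (f n) ^+ 2 + modulus (g n) ^+ 2) * r ^+ (2 * n));
  last first.
  rewrite big_add1 /= big_mkord big_sumType /= -big_split; apply: eq_bigr => i _ /=.
  by rewrite !modulusM !modulusX !modulus_real (ger0_norm r0) mulnC exprM; ring.
move=> <-.
- apply: eq_bigr => j _; congr (modulus _ ^+ 2).
  rewrite big_add1 /= big_mkord big_sumType /= -big_split; apply: eq_bigr => i _ /=.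
  rewrite rmorphM /= rmorphXn /= (conj_unit w1) conjCE conjc_real !exprMn /u /e.
  rewrite expfB ?ltnS -?exprM; last by have := ltn_ord i; lia.
  by rewrite (prim_expr_order wN) mul1r -exprVn -exprM (mulnC j) !mulrA.
- move=> i k /eqP; rewrite /u (eq_prim_root_expr wN) !modn_small; first last.
  + by case: i => i /=; have := ltn_ord i; rewrite /e /N; clear; lia.
  + by case: k => k /=; have := ltn_ord k; rewrite /e /N; clear; lia.
  case: i k => i [] k /= /eqP; rewrite /e => h;
    have := (ltn_ord k, ltn_ord i) => -[ki ii].
  + by congr inl; apply: val_inj => /=; lia.
  + by exfalso; rewrite /N in h; lia.
  + by exfalso; rewrite /N in h; lia.
  + by congr inr; apply: val_inj => /=; rewrite /N in h; lia.
- by move=> i; rewrite /u -exprM mulnC exprM (prim_expr_order wN) expr1n.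
- by move=> i; rewrite /u modulusX w1 expr1n.
Qed.

(** With [M = m + 1], the exponents from [-m] to [m] are separated by [2m + 1] equally spaced points
    of the circle. Averaging the bound over these points replaces an integral. The two polynomials
    are meant for [z F_z] and [conj z F_zbar]. *)
Lemma trig_parseval (M : nat) (r B : R) (f g f' g' : nat -> C) :
  0 < r ->
  (forall z : C, modulus z = r ->
    modulus (\sum_(1 <= n < M) (f n * z ^+ n + g n * z^* ^+ n)) ^+ 2 +
    modulus (\sum_(1 <= n < M) (f' n * z ^+ n + g' n * z^* ^+ n)) ^+ 2 <= B) ->
  \sum_(1 <= n < M) (modulus (f n) ^+ 2 + modulus (g n) ^+ 2 +
     (modulus (f' n) ^+ 2 + modulus (g' n) ^+ 2)) * r ^+ (2 * n) <= B.
Proof.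
(* For [M = 0] the sum is empty and [0 <= B] is read off at [z = r]. *)
move=> r0; case: M => [|m] h.
  rewrite big_geq // (le_trans _ (h r%:C%C _)) ?addr_ge0 ?sqr_ge0 //.
  by rewrite modulus_real gtr0_norm.
have [w wN] := prim_root_exists C (ltn0Sn m.*2).
rewrite -(ler_pM2l (ltr0Sn R m.*2)).
under eq_bigr do rewrite mulrDl.
rewrite big_split mulrDr /= -!(trig_parseval_eq _ _ (ltW r0) wN) -big_split /=.
rewrite [leRHS]mulr_natl -[X in _ *+ X]card_ord -sumr_const ler_sum // => j _.
apply: h; rewrite modulusM modulus_real gtr0_norm // modulusX.
by rewrite (modulus_prim_root _ wN) // expr1n mulr1.
Qed.

End Parseval.

(** * From the condition on arguments to nonnegative inner products *)

Section Angles.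
Variable R : realType.
Local Notation C := (Cplx R).

(** [z conj w = |w|^2 (z / w)], so its real part has the sign of the cosine of [parg (z / w)]. *)
Lemma parg_le_pihalf_Re (z w : C) :
  `|parg (z / w)| <= pi / 2 -> z != 0 -> w != 0 -> 0 <= complex.Re (z * w^*).
Proof.
move=> h z0 w0.
have zw0 : z / w != 0 by rewrite mulf_neq0 // invr_eq0.
have [_ e] := pargP zw0.
have -> : z * w^* = ((modulus w ^+ 2)%:C%C : C) * (z / w).
  by rewrite -mul_conj; field.
rewrite ReM /= mul0r subr0 mulr_ge0 ?sqr_ge0 // e /= mulr_ge0 ?modulus_ge0 //.
by apply: cos_ge0_pihalf; rewrite -ler_norml.
Qed.

(** In the expansion of the right-hand side the cross terms are twice the real inner products, hence
    nonnegative. *)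
Lemma sum_sqr_modulus_le (I : Type) (r : seq I) (P : pred I) (f : I -> C) :
  (forall i j, P i -> P j -> 0 <= complex.Re (f i * (f j)^*)) ->
  \sum_(i <- r | P i) modulus (f i) ^+ 2 <= modulus (\sum_(i <- r | P i) f i) ^+ 2.
Proof.
move=> h.
have modD (z w : C) : modulus (z + w) ^+ 2 =
    modulus z ^+ 2 + modulus w ^+ 2 + 2 * complex.Re (z * w^*).
  by rewrite !sqr_modulus; case: z w => a b [c d] /=; ring.
elim: r => [|i r IH]; first by rewrite !big_nil modulus0 expr0n.
rewrite !big_cons; case: ifP => // Pi; rewrite modD -addrA lerD2l.
rewrite (le_trans IH) // lerDl mulr_ge0 // rmorph_sum mulr_sumr.
by elim/big_ind : _ => [|x y x0 y0|j Pj]; rewrite ?ReD ?addr_ge0 ?h.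
Qed.

End Angles.

(** * Calculus of the Wirtinger derivatives *)

Section Wirtinger.
Variable R : realType.
Local Notation C := (Cplx R).
Local Notation I := (mkC 0 1 : C).

(** A relation that gives existence and value together, so that the rules below deliver both at
    once; componentwise, to match [derivableC]. *)
Definition is_deriveC (g : R -> C) (t : R) (v : C) : Prop :=
  is_derive t (1 : R) (fun s : R => complex.Re (g s)) (complex.Re v) /\
  is_derive t (1 : R) (fun s : R => complex.Im (g s)) (complex.Im v).

Lemma is_deriveC_ext (g h : R -> C) t v w :
  g =1 h -> v = w -> is_deriveC g t v -> is_deriveC h t w.
Proof. by move=> /funext -> ->. Qed.

Lemma is_deriveC_cst (c : C) t : is_deriveC (fun=> c) t 0.
Proof. by split; exact: is_derive_cst. Qed.

Lemma is_deriveCD (g h : R -> C) t v w :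
  is_deriveC g t v -> is_deriveC h t w -> is_deriveC (fun s => g s + h s) t (v + w).
Proof.
move=> [g1 g2] [h1 h2]; split.
  rewrite ReD (_ : (fun s => _) =
    (fun s => complex.Re (g s)) + (fun s => complex.Re (h s))); first exact: is_deriveD.
  by apply/funext => s; rewrite ReD.
rewrite ImD (_ : (fun s => _) =
  (fun s => complex.Im (g s)) + (fun s => complex.Im (h s))); first exact: is_deriveD.
by apply/funext => s; rewrite ImD.
Qed.

Lemma is_deriveCM (g h : R -> C) t v w :
  is_deriveC g t v -> is_deriveC h t w ->
  is_deriveC (fun s => g s * h s) t (v * h t + g t * w).
Proof.
move=> [g1 g2] [h1 h2]; split.
  rewrite (_ : (fun s => _) =
    (fun s => complex.Re (g s)) * (fun s => complex.Re (h s)) -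
    (fun s => complex.Im (g s)) * (fun s => complex.Im (h s))); last first.
    by apply/funext => s; rewrite ReM.
  apply: is_derive_eq; rewrite ReD !ReM /=.
  by rewrite -![_ *: _]/(_ * _); ring.
rewrite (_ : (fun s => _) =
  (fun s => complex.Re (g s)) * (fun s => complex.Im (h s)) +
  (fun s => complex.Im (g s)) * (fun s => complex.Re (h s))); last first.
  by apply/funext => s; rewrite ImM.
apply: is_derive_eq; rewrite ImD !ImM /=.
by rewrite -![_ *: _]/(_ * _); ring.
Qed.

Lemma is_deriveC_conj (g : R -> C) t v :
  is_deriveC g t v -> is_deriveC (fun s => (g s)^*) t v^*.
Proof.
move=> [g1 g2]; split.
  rewrite (_ : (fun s => _) = fun s => complex.Re (g s)); first by case: (v) g1.
  by apply/funext => s; case: (g s).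
rewrite (_ : (fun s => _) = - (fun s => complex.Im (g s))); last first.
  by apply/funext => s; rewrite conjCE /= [RHS]/(- _); case: (g s).
by apply: is_derive_eq; case: (v).
Qed.

(* [f] has partial derivatives at [z], with [f_z = c] and [f_zbar = d]. *)
Definition wirtinger (f : C -> C) (z c d : C) : Prop :=
  is_deriveC (fun s => f (mkC s (complex.Im z))) (complex.Re z) (c + d) /\
  is_deriveC (fun s => f (mkC (complex.Re z) s)) (complex.Im z) (I * (c - d)).

Lemma mkC_ReIm (z : C) : mkC (complex.Re z) (complex.Im z) = z.
Proof. by case: z. Qed.

Lemma mkC_II : I * I = -1 :> C.
Proof. by rewrite -expr2; exact: sqr_i. Qed.

Lemma wirtinger_ext (f g : C -> C) z c d c' d' :
  f =1 g -> c = c' -> d = d' -> wirtinger f z c d -> wirtinger g z c' d'.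
Proof. by move=> /funext -> -> ->. Qed.

Lemma wirtinger_cst (a z : C) : wirtinger (fun=> a) z 0 0.
Proof.
by split; apply: is_deriveC_ext (is_deriveC_cst _ _); rewrite ?subrr ?mulr0 ?addr0.
Qed.

Lemma wirtinger_id (z : C) : wirtinger id z 1 0.
Proof.
split; rewrite ?addr0 ?subr0 ?mulr1; split => /=.
- exact: is_derive_id.
- exact: is_derive_cst.
- exact: is_derive_cst.
- exact: is_derive_id.
Qed.

Lemma wirtinger_conj (f : C -> C) z c d :
  wirtinger f z c d -> wirtinger (fun w => (f w)^*) z d^* c^*.
Proof.
move=> [f1 f2]; split; [move: f1 | move: f2] => /is_deriveC_conj;
  apply: is_deriveC_ext => //.
  by rewrite rmorphD addrC.
rewrite rmorphM rmorphB /= (_ : I^* = - I) ?mulNr ?mulrBr ?opprB //.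
by apply/eqP; rewrite eq_complex /= oppr0 !eqxx.
Qed.

Lemma wirtingerD (f g : C -> C) z c d c' d' :
  wirtinger f z c d -> wirtinger g z c' d' ->
  wirtinger (fun w => f w + g w) z (c + c') (d + d').
Proof.
move=> [f1 f2] [g1 g2]; split.
  by apply: is_deriveC_ext (is_deriveCD f1 g1) => //; ring.
by apply: is_deriveC_ext (is_deriveCD f2 g2) => //; ring.
Qed.

Lemma wirtingerM (f g : C -> C) z c d c' d' :
  wirtinger f z c d -> wirtinger g z c' d' ->
  wirtinger (fun w => f w * g w) z (c * g z + f z * c') (d * g z + f z * d').
Proof.
move=> [f1 f2] [g1 g2]; split.
  by apply: is_deriveC_ext (is_deriveCM f1 g1) => //; rewrite mkC_ReIm; ring.
by apply: is_deriveC_ext (is_deriveCM f2 g2) => //; rewrite mkC_ReIm; ring.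
Qed.

Lemma wirtingerB (f g : C -> C) z c d c' d' :
  wirtinger f z c d -> wirtinger g z c' d' ->
  wirtinger (fun w => f w - g w) z (c - c') (d - d').
Proof.
move=> hf /(wirtingerM (wirtinger_cst (-1) z)) /(wirtingerD hf).
by apply: wirtinger_ext => [w||]; rewrite ?mul0r ?add0r ?mulN1r.
Qed.

Lemma wirtingerX n (z : C) :
  wirtinger (fun w => w ^+ n) z (n%:R * z ^+ n.-1) 0.
Proof.
elim: n => [|n IH].
  by apply: wirtinger_ext (wirtinger_cst 1 z) => //; rewrite mul0r.
apply: wirtinger_ext (wirtingerM (wirtinger_id z) IH) => [w||].
- by rewrite exprS.
- rewrite mul1r /= mulrCA; case: n IH => [|n] IH; first by rewrite mul0r mul1r addr0.
  by rewrite -exprS [in RHS]mulrSr; ring.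
- by rewrite mul0r mulr0 addr0.
Qed.

Lemma wirtinger_monomial i j (z : C) :
  wirtinger (fun w => w ^+ i * w^* ^+ j) z
    (i%:R * z ^+ i.-1 * z^* ^+ j) (j%:R * z ^+ i * z^* ^+ j.-1).
Proof.
have := wirtinger_conj (wirtingerX j z) => /(wirtingerM (wirtingerX i z)).
apply: wirtinger_ext => [w||].
- by rewrite rmorphXn.
- by rewrite rmorphXn rmorph0 mulr0 addr0.
- by rewrite mul0r add0r !rmorphM !rmorphXn rmorph_nat mulrCA mulrA.
Qed.

Lemma wirtingerZ (a : C) (f : C -> C) z c d :
  wirtinger f z c d -> wirtinger (fun w => a * f w) z (a * c) (a * d).
Proof.
move=> /(wirtingerM (wirtinger_cst a z)).
by apply: wirtinger_ext => //; rewrite mul0r add0r.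
Qed.

Lemma wirtinger_sum (J : Type) (r : seq J) (f : J -> C -> C) z (c d : J -> C) :
  (forall j, wirtinger (f j) z (c j) (d j)) ->
  wirtinger (fun w => \sum_(j <- r) f j w) z (\sum_(j <- r) c j) (\sum_(j <- r) d j).
Proof.
move=> h; elim: r => [|j r IH].
  apply: wirtinger_ext (wirtinger_cst 0 z) => [w||]; by rewrite big_nil.
by apply: wirtinger_ext (wirtingerD (h j) IH) => [w||]; rewrite big_cons.
Qed.

Lemma derivable_is_derive1 (g : R -> R) (t : R) :
  derivable g t 1 -> is_derive t (1 : R) g (derive1 g t).
Proof. by move=> dg; rewrite derive1E; exact: DeriveDef. Qed.

Lemma partially_derivable_wirtinger (f : C -> C) z :
  partially_derivable f z -> wirtinger f z (dz f z) (dzbar f z).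
Proof.
move=> [[f1 f2] [f3 f4]].
have -> : wirtinger f z (dz f z) (dzbar f z) = (
  is_deriveC (fun s => f (mkC s (complex.Im z))) (complex.Re z) (dx f z) /\
  is_deriveC (fun s => f (mkC (complex.Re z) s)) (complex.Im z) (dy f z)).
  rewrite /wirtinger; congr (is_deriveC _ _ _ /\ is_deriveC _ _ _).
    by rewrite /dz /dzbar; field.
  rewrite (_ : dz f z - dzbar f z = - (I * dy f z)); last first.
    by rewrite /dz /dzbar; field.
  by rewrite mulrN mulrA mkC_II mulN1r opprK.
split.
  split; [exact: (derivable_is_derive1 f1)|exact: (derivable_is_derive1 f2)].
split; [exact: (derivable_is_derive1 f3)|exact: (derivable_is_derive1 f4)].
Qed.

Lemma derive_lipschitz (g : R -> R) (t v L del : R) : 0 < del ->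
  (forall s, `|s - t| < del -> `|g s - g t| <= L * `|s - t|) ->
  is_derive t (1 : R) g v -> `|v| <= L.
Proof.
move=> d0 lip [dg <-].
have cv : `|h^-1 *: (g (h *: (1 : R) + t) - g t)| @[h --> 0^'] --> `|'D_1 g t|.
  exact: cvg_norm dg.
rewrite -(cvg_lim _ cv) //; apply: limr_le; first by apply/cvg_ex; eexists; exact: cv.
near=> h; have hE : h *: (1 : R) + t - t = h.
  by rewrite addrK -[_ *: _]/(_ * _) mulr1.
have h0 : h != 0 by near: h; exact: nbhs_dnbhs_neq.
rewrite normrM normfV ler_pdivrMl ?normr_gt0 // mulrC.
have := lip (h *: (1 : R) + t); rewrite hE; apply.
by near: h; exact: dnbhs0_lt.
Unshelve. all: by end_near. Qed.

(** The real and imaginary parts of [f_x = c + d] and of [f_y = I (c - d)] are at most [L] in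
    absolute value, so [c + d] and [c - d] have modulus at most [2L]; halving their sum and
    difference gives [c] and [d]. *)
Lemma wirtinger_lipschitz (f : C -> C) (z c d : C) (L del : R) : 0 < del ->
  (forall w, modulus (w - z) < del ->
     modulus (f w - f z) <= L * modulus (w - z)) ->
  wirtinger f z c d -> modulus c <= 2 * L /\ modulus d <= 2 * L.
Proof.
move=> d0 lip [[f1 f2] [f3 f4]].
have deltaR s : modulus (mkC s (complex.Im z) - z) = `|s - complex.Re z|.
  rewrite -modulus_real; congr modulus; case: (z) => x y /=.
  by apply/eqP; rewrite eq_complex /= subrr !eqxx.
have deltaI s : modulus (mkC (complex.Re z) s - z) = `|s - complex.Im z|.
  case: (z) => x y /=.
  by rewrite /modulus /= subrr expr0n add0r sqrtr_sqr.
have lipR s : `|s - complex.Re z| < del ->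
    modulus (f (mkC s (complex.Im z)) - f z) <= L * `|s - complex.Re z|.
  by rewrite -deltaR => /lip.
have lipI s : `|s - complex.Im z| < del ->
    modulus (f (mkC (complex.Re z) s) - f z) <= L * `|s - complex.Im z|.
  by rewrite -deltaI => /lip.
have cd : modulus (c + d) <= L + L.
  rewrite (le_trans (modulus_le_ReIm _)) // lerD //.
    apply: derive_lipschitz d0 _ f1 => s /lipR; apply: le_trans.
    by rewrite mkC_ReIm -ReB Re_le_modulus.
  apply: derive_lipschitz d0 _ f2 => s /lipR; apply: le_trans.
  by rewrite mkC_ReIm -ImB Im_le_modulus.
have cmd : modulus (c - d) <= L + L.
  rewrite -[modulus _]mul1r -(modulus_i R) -modulusM (le_trans (modulus_le_ReIm _)) // lerD //.
    apply: derive_lipschitz d0 _ f3 => s /lipI; apply: le_trans.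
    by rewrite mkC_ReIm -ReB Re_le_modulus.
  apply: derive_lipschitz d0 _ f4 => s /lipI; apply: le_trans.
  by rewrite mkC_ReIm -ImB Im_le_modulus.
have two (u : C) : 2 * modulus u = modulus (2 * u) by rewrite modulusM modulus_nat.
split; rewrite -(ler_pM2l (ltr0n R 2)) two.
  rewrite (_ : 2 * c = (c + d) + (c - d)); last by ring.
  by rewrite (le_trans (modulusD _ _)) // mulr_natl mulr2n mulr_natl lerD.
rewrite (_ : 2 * d = (c + d) - (c - d)); last by ring.
by rewrite (le_trans (modulusB _ _)) // mulr_natl mulr2n mulr_natl lerD.
Qed.

End Wirtinger.

(** * Termwise control of the polyharmonic series and its derivatives *)

Section Series.
Variable R : realType.
Local Notation C := (Cplx R).

(** Limits in [Cplx R] use tolerances that are positive elements of [C]. These are real, so real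
    tolerances on [modulus] suffice. *)
Lemma cvgn_modulusP (u : nat -> C) (l : C) :
  u @ \oo --> l <->
  forall e : R, 0 < e -> exists N, forall n, (N <= n)%N -> modulus (u n - l) <= e.
Proof.
split=> [/cvgrPdist_le h e e0|h].
  have e0' : 0 < (e%:C%C : C) by rewrite ltcR.
  have [N _ hN] := h _ e0'; exists N => n Nn.
  by have := hN n Nn; rewrite /= distrC normE lecR.
apply/cvgrPdist_le => e e0.
have eE : e = ((complex.Re e)%:C%C : C) by apply/esym/RRe_real/gtr0_real.
have [|N hN] := h (complex.Re e); first by move: e0; rewrite eE ltcR.
by exists N => // n Nn; rewrite distrC eE normE lecR hN.
Qed.

Lemma cvgn_conj (u : nat -> C) (l : C) :
  u @ \oo --> l -> (fun n => (u n)^*) @ \oo --> l^*.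
Proof.
move=> /cvgn_modulusP h; apply/cvgn_modulusP => e /h [N hN].
by exists N => n /hN; rewrite -rmorphB modulus_conj.
Qed.

(** Each of the [n] powers [t^i] with [i < n] is at least [t^n], and their sum is at most
    [1 / (1 - t)]. *)
Lemma mulrn_expr_le (t : R) n : 0 < t < 1 -> n%:R * t ^+ n <= (1 - t)^-1.
Proof.
move=> /andP[t0 t1].
rewrite -[_^-1]mul1r ler_pdivlMr ?subr_gt0 // -mulrA.
have : n%:R * t ^+ n <= \sum_(i < n) t ^+ i.
  rewrite mulr_natl -[X in _ *+ X]card_ord -sumr_const ler_sum // => i _.
  by apply: ler_wiXn2l; rewrite ?(ltW t0) ?(ltW t1) // ltnW.
rewrite -(ler_pM2r (x := 1 - t)) ?subr_gt0 // mulrA => /le_trans; apply.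
rewrite mulrC -opprB mulNr -subrX1 opprB lerBlDr lerDl.
by rewrite exprn_ge0 // ltW.
Qed.

(** A term is the difference of two consecutive partial sums at [z = t]. From some [N] on both lie
    within 1 of the limit, which gives the bound 2; the finitely many earlier terms are added to the
    constant. *)
Lemma analytic_series_bounded (c : nat -> C) (t : R) :
  analytic_series c -> 0 < t < 1 ->
  exists2 B : R, 0 <= B & forall n, (1 <= n)%N -> modulus (c n) * t ^+ n <= B.
Proof.
move=> an /andP[t0 t1].
have tD : unit_disc (t%:C%C : C) by apply/unit_discE; rewrite modulus_real gtr0_norm.
have /cvg_ex [l /cvgn_modulusP /(_ 1 ltr01) [N hN]] := an _ tD.
exists (2 + \sum_(1 <= n < N) modulus (c n) * t ^+ n).
  by rewrite addr_ge0 // sumr_ge0 // => i _; rewrite mulr_ge0 ?modulus_ge0 ?exprn_ge0 ?ltW.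
have pos n : 0 <= modulus (c n) * t ^+ n.
  by rewrite mulr_ge0 ?modulus_ge0 ?exprn_ge0 ?ltW.
move=> n n1; have [Nn|nN] := leqP N n; last first.
  rewrite (bigD1_seq n) ?iota_uniq ?mem_index_iota ?n1 //=.
  by rewrite addrCA lerDl addr_ge0 // sumr_ge0.
rewrite -[leLHS]addr0 lerD ?sumr_ge0 //.
rewrite -{1}(gtr0_norm t0) -modulus_real -modulusX -modulusM.
rewrite (_ : c n * _ = (\sum_(1 <= i < n.+1) c i * (t%:C%C : C) ^+ i - l) -
    (\sum_(1 <= i < n) c i * (t%:C%C : C) ^+ i - l)); last first.
  by rewrite big_nat_recr //=; ring.
by rewrite (le_trans (modulusB _ _)) // (lerD (hN _ (leqW Nn)) (hN _ Nn)).
Qed.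

(* Of the three factors [t^n], one bounds [c n], one absorbs [n + m], and one is
   left. *)
Lemma analytic_series_decay (c : nat -> C) (m : nat) (rho t : R) :
  analytic_series c -> 0 <= rho -> 0 < t < 1 -> rho <= t ^+ 3 ->
  exists2 B : R, 0 <= B &
    forall n, (1 <= n)%N -> (n + m)%:R * modulus (c n) * rho ^+ n <= B * t ^+ n.
Proof.
move=> an rho0 t01 rhot; have [B B0 hB] := analytic_series_bounded an t01.
have /andP[t0 t1] := t01.
have t1' : 0 <= (1 - t)^-1 by rewrite invr_ge0 subr_ge0 ltW.
exists (((1 - t)^-1 + m%:R) * B); first by rewrite mulr_ge0 // addr_ge0.
move=> n n1.
have tn k : 0 <= t ^+ k by rewrite exprn_ge0 // ltW.
apply: (@le_trans _ _ ((n + m)%:R * modulus (c n) * (t ^+ n * t ^+ n * t ^+ n))).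
  rewrite ler_wpM2l ?mulr_ge0 ?modulus_ge0 // -!exprMn.
  by apply: lerXn2r; rewrite ?nnegrE ?mulr_ge0 ?(ltW t0) // -expr2 -exprSr.
rewrite (_ : _ * _ = ((n + m)%:R * t ^+ n) * (modulus (c n) * t ^+ n) * t ^+ n); last by ring.
rewrite ler_wpM2r // ler_pM ?mulr_ge0 ?modulus_ge0 ?hB //.
rewrite natrD mulrDl lerD ?mulrn_expr_le // ler_piMr //.
by rewrite exprn_ile1 // ltW.
Qed.

Lemma sum_nat_decay (t : R) (q : nat) (u : nat -> nat -> R) :
  0 < t ->
  (forall k, (1 <= k < q)%N -> exists2 B : R, 0 <= B &
    forall n, (1 <= n)%N -> u k n <= B * t ^+ n) ->
  exists2 B : R, 0 <= B &
    forall n, (1 <= n)%N -> \sum_(1 <= k < q) u k n <= B * t ^+ n.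
Proof.
move=> t0; elim: q => [|q IH] h.
  by exists 0 => // n _; rewrite big_geq // mul0r.
case: q => [|q] in IH h *; first by exists 0 => // n _; rewrite big_geq // mul0r.
have [|B B0 hB] := IH; first by move=> k /andP[k1 kq]; apply: h; rewrite k1 ltnW.
have [|B' B0' hB'] := h q.+1; first by rewrite /= ltnS leqnn.
exists (B + B') => [|n n1]; first exact: addr_ge0.
by rewrite big_nat_recr //= mulrDl lerD ?hB ?hB'.
Qed.

Lemma sum_expr_tail (t : R) (M N : nat) : 0 < t < 1 ->
  \sum_(M <= n < N) t ^+ n <= t ^+ M / (1 - t).
Proof.
move=> /andP[t0 t1]; rewrite ler_pdivlMr ?subr_gt0 //.
have [MN|NM] := leqP M N; last first.
  by rewrite big_geq ?mul0r ?exprn_ge0 ?ltW // ltnW.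
rewrite mulr_suml (eq_bigr (fun n => - (t ^+ n.+1) - - (t ^+ n))) => [|i _].
  by rewrite telescope_sumr // opprK addrC gerBl exprn_ge0 // ltW.
by rewrite exprS; ring.
Qed.

Definition monomial (i j : nat) (z : C) : C := z ^+ i * z^* ^+ j.

(** The usual constant is [n rho^(n-1)]; the extra factor [rho] on both sides avoids the
    predecessor, and with it a special case at [n = 0]. *)
Lemma expr_lipschitz (rho : R) (z w : C) n :
  modulus z <= rho -> modulus w <= rho ->
  rho * modulus (z ^+ n - w ^+ n) <= n%:R * rho ^+ n * modulus (z - w).
Proof.
move=> zr wr; have r0 := le_trans (modulus_ge0 z) zr.
elim: n => [|n IH]; first by rewrite subrr modulus0 mulr0 !mul0r.
rewrite (_ : _ - _ = z * (z ^+ n - w ^+ n) + (z - w) * w ^+ n); last first.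
  by rewrite !exprS; ring.
apply: (@le_trans _ _ (rho * (rho * modulus (z ^+ n - w ^+ n)) +
  rho * (modulus (z - w) * rho ^+ n))).
  rewrite -mulrDr ler_wpM2l // (le_trans (modulusD _ _)) // !modulusM.
  rewrite lerD ?ler_wpM2r ?modulus_ge0 // ler_wpM2l ?modulus_ge0 // modulusX.
  by apply: lerXn2r; rewrite ?nnegrE ?modulus_ge0.
apply: (@le_trans _ _ (rho * (n%:R * rho ^+ n * modulus (z - w)) +
  rho * (modulus (z - w) * rho ^+ n))); first by rewrite lerD2r ler_wpM2l.
by rewrite -natr1 exprS le_eqVlt; apply/orP; left; apply/eqP; ring.
Qed.

Lemma monomial_lipschitz (rho : R) (z w : C) i j :
  modulus z <= rho -> modulus w <= rho ->
  rho * modulus (monomial i j z - monomial i j w) <=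
  (i + j)%:R * rho ^+ (i + j) * modulus (z - w).
Proof.
move=> zr wr; have r0 := le_trans (modulus_ge0 z) zr.
have leX (u : C) k : modulus u <= rho -> modulus (u ^+ k) <= rho ^+ k.
  by move=> ur; rewrite modulusX; apply: lerXn2r; rewrite ?nnegrE ?modulus_ge0.
rewrite (_ : _ - _ = (z ^+ i - w ^+ i) * z^* ^+ j +
    w ^+ i * (z^* ^+ j - w^* ^+ j)); last by rewrite /monomial; ring.
apply: (@le_trans _ _ (rho * modulus (z ^+ i - w ^+ i) * rho ^+ j +
    rho ^+ i * (rho * modulus (z^* ^+ j - w^* ^+ j)))).
  rewrite mulrCA -mulrA -mulrDr ler_wpM2l // (le_trans (modulusD _ _)) //.
  rewrite !modulusM lerD // ?ler_wpM2l ?ler_wpM2r ?modulus_ge0 ?leX //.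
  by rewrite modulus_conj.
have hi := expr_lipschitz i zr wr.
have hj : rho * modulus (z^* ^+ j - w^* ^+ j) <= j%:R * rho ^+ j * modulus (z - w).
  rewrite -(modulus_conj (z - w)) rmorphB.
  by apply: expr_lipschitz; rewrite modulus_conj.
apply: (le_trans (lerD (ler_wpM2r (exprn_ge0 j r0) hi) (ler_wpM2l (exprn_ge0 i r0) hj))).
by rewrite natrD exprD le_eqVlt; apply/orP; left; apply/eqP; ring.
Qed.

(** The factor [|z|^(2(k-1))] is written as [(z conj z)^(k-1)], which makes every term a polynomial
    in [z] and [conj z]. *)
Definition poly_term (a b : nat -> nat -> C) n k (z : C) : C :=
  a n k * monomial (n + (k - 1)) (k - 1) z +
  (b n k)^* * monomial (k - 1) (n + (k - 1)) z.

Definition poly_sum p (a b : nat -> nat -> C) N (z : C) : C :=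
  \sum_(1 <= k < p.+1) \sum_(1 <= n < N) poly_term a b n k z.

Lemma poly_termE a b n k (z : C) :
  poly_term a b n k z =
  `|z| ^+ (2 * (k - 1)) * (a n k * z ^+ n + (b n k * z ^+ n)^*).
Proof.
rewrite exprM normCK rmorphM rmorphXn /poly_term /monomial !exprD.
by rewrite exprMn; ring.
Qed.

Lemma poly_sum_cvg p a0 a b (F : C -> C) z :
  polyharmonic_series p a0 a b F -> unit_disc z ->
  (fun N => a0 + poly_sum p a b N z) @ \oo --> F z.
Proof.
move=> [an FE] zD; rewrite FE //; apply: cvgD; first exact: cvg_cst.
rewrite (_ : poly_sum p a b ^~ z = fun N => \sum_(1 <= k < p.+1 | (1 <= k < p.+1)%N)
  `|z| ^+ (2 * (k - 1)) * \sum_(1 <= n < N) (a n k * z ^+ n + (b n k * z ^+ n)^*));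
  last first.
  apply/funext => N; rewrite /poly_sum big_nat; apply: eq_bigr => k _.
  by rewrite mulr_sumr; apply: eq_bigr => n _; rewrite poly_termE.
rewrite big_nat; apply: cvg_big => [|k k1p]; first exact: add_continuous.
apply: cvgM; first exact: cvg_cst.
have [/(_ z zD) ha /(_ z zD) hb] := an k k1p.
rewrite (_ : (fun N => _) = (fun N => \sum_(1 <= n < N) a n k * z ^+ n) +
    (fun N => (\sum_(1 <= n < N) b n k * z ^+ n)^*)); last first.
  by apply/funext => N; rewrite big_split /= -rmorph_sum.
exact: (cvgP _ (cvgD ha (cvgn_conj hb))).
Qed.

(** The factor [n + 2p] dominates the total degree [n + 2(k-1)] of every monomial of index [n], and
    so its Lipschitz constant. *)
Lemma poly_sum_decay p (a b : nat -> nat -> C) (rho t : R) :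
  (forall k, (1 <= k <= p)%N -> analytic_series (a ^~ k) /\ analytic_series (b ^~ k)) ->
  0 <= rho -> 0 < t < 1 -> rho <= t ^+ 3 ->
  exists2 B : R, 0 <= B & forall n, (1 <= n)%N ->
    \sum_(1 <= k < p.+1) (n + 2 * p)%:R * (modulus (a n k) + modulus (b n k)) * rho ^+ n
      <= B * t ^+ n.
Proof.
move=> an rho0 t01 rhot; have /andP[t0 t1] := t01.
apply: sum_nat_decay => // k k1p; have [ak bk] := an k k1p.
have [B B0 hB] := analytic_series_decay (2 * p) ak rho0 t01 rhot.
have [B' B0' hB'] := analytic_series_decay (2 * p) bk rho0 t01 rhot.
exists (B + B') => [|n n1]; first exact: addr_ge0.
by rewrite mulrDr !mulrDl lerD ?hB ?hB'.
Qed.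

Lemma poly_sum_lipschitz p (a b : nat -> nat -> C) (rho t : R) :
  (forall k, (1 <= k <= p)%N -> analytic_series (a ^~ k) /\ analytic_series (b ^~ k)) ->
  0 < rho -> 0 < t < 1 -> rho <= t ^+ 3 ->
  exists2 B : R, 0 <= B & forall M N z w, (1 <= M <= N)%N ->
    modulus z <= rho -> modulus w <= rho ->
    modulus ((poly_sum p a b N z - poly_sum p a b M z) -
             (poly_sum p a b N w - poly_sum p a b M w))
      <= B * t ^+ M * modulus (z - w).
Proof.
move=> an rho0 t01 rhot; have /andP[t0 t1] := t01.
have [B B0 hB] := poly_sum_decay an (ltW rho0) t01 rhot.
have rho1 : rho <= 1 by rewrite (le_trans rhot) // exprn_ile1 // ltW.
(* [1 / (1 - t)] comes from the geometric tail, and [1 / rho] undoes the factor [rho] in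
   [monomial_lipschitz]. *)
exists (B / (1 - t) / rho) => [|M N z w /andP[M1 MN] zr wr].
  by rewrite !divr_ge0 // ?subr_ge0 ltW.
have diffE u : poly_sum p a b N u - poly_sum p a b M u =
    \sum_(1 <= k < p.+1) \sum_(M <= n < N) poly_term a b n k u.
  rewrite /poly_sum -sumrB; apply: eq_bigr => k _.
  by rewrite (big_cat_nat M1 MN) /= addrAC subrr add0r.
rewrite !diffE -sumrB -(ler_pM2l rho0).
under eq_bigr do rewrite -sumrB.
apply: (@le_trans _ _ (\sum_(1 <= k < p.+1) \sum_(M <= n < N)
   rho * modulus (poly_term a b n k z - poly_term a b n k w))).
  under [leRHS]eq_bigr do rewrite -mulr_sumr.
  rewrite -mulr_sumr ler_wpM2l ?(ltW rho0) // (le_trans (modulus_sum _ _ _)) //.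
  by apply: ler_sum => k _; exact: modulus_sum.
apply: (@le_trans _ _ (\sum_(1 <= k < p.+1) \sum_(M <= n < N)
   (n + 2 * p)%:R * (modulus (a n k) + modulus (b n k)) * rho ^+ n * modulus (z - w))).
  rewrite !big_nat; apply: ler_sum => k /andP[k1 kp].
  apply: ler_sum => n _.
  rewrite (_ : poly_term a b n k z - _ =
    a n k * (monomial (n + (k - 1)) (k - 1) z - monomial (n + (k - 1)) (k - 1) w) +
    (b n k)^* * (monomial (k - 1) (n + (k - 1)) z - monomial (k - 1) (n + (k - 1)) w));
    last by rewrite /poly_term; ring.
  (* Since [rho <= 1], the power [rho^(n + 2(k-1))] may be raised to [rho^n]. *)
  have bnd i j : (i + j = n + 2 * (k - 1))%N ->
      rho * modulus (monomial i j z - monomial i j w) <=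
      (n + 2 * p)%:R * rho ^+ n * modulus (z - w).
    move=> ij; apply: (le_trans (monomial_lipschitz i j zr wr)).
    rewrite ler_wpM2r ?modulus_ge0 // ler_pM ?exprn_ge0 ?(ltW rho0) //.
      by rewrite ler_nat ij leq_add2l leq_mul2l /= (leq_trans (leq_subr _ _)).
    by apply: ler_wiXn2l; rewrite ?(ltW rho0) // ij leq_addr.
  apply: (@le_trans _ _ (modulus (a n k) *
      (rho * modulus (monomial (n + (k - 1)) (k - 1) z - monomial (n + (k - 1)) (k - 1) w)) +
    modulus (b n k) *
      (rho * modulus (monomial (k - 1) (n + (k - 1)) z - monomial (k - 1) (n + (k - 1)) w)))).
    rewrite 2!(mulrCA _ rho) -mulrDr ler_wpM2l ?(ltW rho0) //.
    by rewrite (le_trans (modulusD _ _)) // !modulusM modulus_conj.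
  rewrite [leRHS](_ : _ = modulus (a n k) * ((n + 2 * p)%:R * rho ^+ n * modulus (z - w)) +
    modulus (b n k) * ((n + 2 * p)%:R * rho ^+ n * modulus (z - w))); last by ring.
  by rewrite lerD // ler_wpM2l ?modulus_ge0 // bnd //; lia.
rewrite exchange_big /=.
under eq_bigr do rewrite -mulr_suml.
rewrite -mulr_suml [leRHS](_ : _ = B * (t ^+ M / (1 - t)) * modulus (z - w)); last first.
  by field; rewrite ?subr_eq0 gt_eqF //= gt_eqF.
rewrite ler_wpM2r ?modulus_ge0 //.
apply: le_trans (ler_wpM2l B0 (sum_expr_tail M N t01)); rewrite mulr_sumr.
rewrite !big_nat; apply: ler_sum => n /andP[Mn _]; apply: hB.
exact: leq_trans Mn.
Qed.

(** Let [N] tend to infinity in [poly_sum_lipschitz]: the constant does not depend on [N], and [a0]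
    cancels between [z] and [w]. *)
Lemma poly_series_lipschitz p a0 a b (F : C -> C) (rho t : R) :
  polyharmonic_series p a0 a b F -> 0 < rho -> 0 < t < 1 -> rho <= t ^+ 3 ->
  exists2 B : R, 0 <= B & forall M z w, (1 <= M)%N ->
    modulus z <= rho -> modulus w <= rho ->
    modulus ((F z - poly_sum p a b M z) - (F w - poly_sum p a b M w))
      <= B * t ^+ M * modulus (z - w).
Proof.
move=> hF rho0 t01 rhot; have /andP[t0 t1] := t01.
have [B B0 hB] := poly_sum_lipschitz hF.1 rho0 t01 rhot.
have rho1 : rho < 1 by rewrite (le_lt_trans rhot) // exprn_ilt1 // ltW.
exists B => // M z w M1 zr wr; apply/ler_addgt0Pr => e e0.
have D u : modulus u <= rho -> unit_disc u.
  by move=> ur; apply/unit_discE/(le_lt_trans ur).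
have e2 : 0 < e / 2 by rewrite divr_gt0.
have /cvgn_modulusP/(_ _ e2)[N1 hN1] := poly_sum_cvg hF (D _ zr).
have /cvgn_modulusP/(_ _ e2)[N2 hN2] := poly_sum_cvg hF (D _ wr).
pose N := maxn M (maxn N1 N2).
have MN : (1 <= M <= N)%N by rewrite M1 leq_maxl.
have := hB M N z w MN zr wr; set X := modulus (_ - _) => hX.
have {}hN1 : modulus (a0 + poly_sum p a b N z - F z) <= e / 2.
  by apply: hN1; rewrite /N; lia.
have {}hN2 : modulus (a0 + poly_sum p a b N w - F w) <= e / 2.
  by apply: hN2; rewrite /N; lia.
rewrite (_ : F z - _ - _ = (poly_sum p a b N z - poly_sum p a b M z -
     (poly_sum p a b N w - poly_sum p a b M w)) -
   (a0 + poly_sum p a b N z - F z - (a0 + poly_sum p a b N w - F w))); last by ring.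
rewrite (le_trans (modulusB _ _)) // lerD // (le_trans (modulusB _ _)) //.
by rewrite (splitr e) lerD.
Qed.

Definition poly_dz p (a b : nat -> nat -> C) M (z : C) : C :=
  \sum_(1 <= k < p.+1) \sum_(1 <= n < M)
    (a n k * ((n + (k - 1))%:R * z ^+ (n + (k - 1)).-1 * z^* ^+ (k - 1)) +
     (b n k)^* * ((k - 1)%:R * z ^+ (k - 1).-1 * z^* ^+ (n + (k - 1)))).

Definition poly_dzbar p (a b : nat -> nat -> C) M (z : C) : C :=
  \sum_(1 <= k < p.+1) \sum_(1 <= n < M)
    (a n k * ((k - 1)%:R * z ^+ (n + (k - 1)) * z^* ^+ (k - 1).-1) +
     (b n k)^* * ((n + (k - 1))%:R * z ^+ (k - 1) * z^* ^+ (n + (k - 1)).-1)).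

Lemma poly_sum_wirtinger p a b M (z : C) :
  wirtinger (poly_sum p a b M) z (poly_dz p a b M z) (poly_dzbar p a b M z).
Proof.
apply: wirtinger_sum => k; apply: wirtinger_sum => n.
by apply: wirtingerD; apply: wirtingerZ; exact: wirtinger_monomial.
Qed.

(* No termwise differentiation: the remainder [F - poly_sum p a b M] has a
   Lipschitz constant decaying like [t^M], which bounds its derivatives. *)
Lemma poly_series_deriv p a0 a b (F : C -> C) (r : R) :
  polyharmonic_series p a0 a b F ->
  (forall z, unit_disc z -> partially_derivable F z) -> 0 <= r < 1 ->
  exists B t : R, [/\ 0 <= B, 0 < t < 1 & forall M z, (1 <= M)%N -> modulus z <= r ->
    modulus (dz F z - poly_dz p a b M z) <= B * t ^+ M /\
    modulus (dzbar F z - poly_dzbar p a b M z) <= B * t ^+ M].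
Proof.
move=> hF dF /andP[r0 r1].
(* [rho] exceeds [r], which leaves room for a neighbourhood of [z]. With this [t], [rho = 3t - 2] is
   the tangent to the cube at 1, hence lies below [t^3]. *)
pose rho := (1 + r) / 2; pose t := (2 + rho) / 3.
have rrho : r < rho by rewrite /rho; lra.
have rho1 : rho < 1 by rewrite /rho; lra.
have t01 : 0 < t < 1 by rewrite /t; lra.
have rho0 : 0 < rho by exact: le_lt_trans rrho.
have rhot : rho <= t ^+ 3.
  have -> : rho = 3 * t - 2 by rewrite /t; field.
  rewrite -subr_ge0 (_ : _ - _ = (t - 1) ^+ 2 * (t + 2)); last by ring.
  by rewrite mulr_ge0 ?sqr_ge0 // addr_ge0 //; case/andP: t01 => /ltW.
have [B B0 hB] := poly_series_lipschitz hF rho0 t01 rhot.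
(* The factor 2 is the one in [wirtinger_lipschitz]. *)
exists (2 * B), t; split => //; first by rewrite mulr_ge0.
move=> M z M1 zr.
have zD : unit_disc z by apply/unit_discE/(le_lt_trans zr).
have W := wirtingerB (partially_derivable_wirtinger (dF z zD))
  (poly_sum_wirtinger p a b M z).
have d0 : 0 < rho - r by rewrite subr_gt0.
rewrite -mulrA; apply: wirtinger_lipschitz d0 _ W => w wz.
apply: hB => //; last by rewrite (le_trans zr) // ltW.
rewrite -[w](subrK z) (le_trans (modulusD _ _)) // -(subrK r rho).
by rewrite lerD // ltW.
Qed.

End Series.

(** * From the almost everywhere dilatation inequality to a pointwise energy bound *)

Section AlmostEverywhere.
Variable R : realType.
Local Notation C := (Cplx R).

(** Otherwise a whole square with a corner at [z] would lie in the exceptional null set, although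
    its area is positive. *)
Lemma ae_disc_dense (P : C -> Prop) (z : C) (e : R) :
  {ae @area R, forall w : plane R, unit_disc (mkC w.1 w.2) -> P (mkC w.1 w.2)} ->
  unit_disc z -> 0 < e ->
  exists w, [/\ modulus (w - z) < e, unit_disc w & P w].
Proof.
move=> [A [mA A0 hA]] zD e0; apply: contrapT => hno.
have z1 : 0 < 1 - modulus z by rewrite subr_gt0; exact/unit_discE.
(* Halved because the distance to [z] is estimated by the sum of the two coordinate differences; the
   bound [1 - modulus z] keeps the square in the disc. *)
pose d := Num.min e (1 - modulus z) / 2.
have d0 : 0 < d by rewrite divr_gt0 // lt_min e0.
have near w : `|complex.Re w - complex.Re z| < d -> `|complex.Im w - complex.Im z| < d ->
    modulus (w - z) < e /\ unit_disc w.
  move=> h1 h2.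
  have h : modulus (w - z) < Num.min e (1 - modulus z).
    rewrite (le_lt_trans (modulus_le_ReIm _)) // [ltRHS](splitr _).
    by rewrite ReB ImB ltrD.
  move: h; rewrite lt_min => /andP[h h3]; split => //; apply/unit_discE.
  by rewrite -[w](subrK z) (le_lt_trans (modulusD _ _)) // -ltrBrDr.
pose I (x : R) := `]x, (x + d)[%classic : set (measurableTypeR R).
have mI x : measurable (I x) by exact: measurable_itv.
have lI x : (@lebesgue_measure R (I x) = d%:E)%E.
  by rewrite lebesgue_measure_itv /= lte_fin ltrDl d0 -EFinD addrAC subrr add0r.
have QA : I (complex.Re z) `*` I (complex.Im z) `<=` A.
  apply: subset_trans hA => -[x y] []; rewrite /I /= !in_itv /= => /andP[x1 x2] /andP[y1 y2] h.
  have [|| h1 h2] := near (mkC x y).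
  - by rewrite /= ger0_norm ?subr_ge0 ?ltW // ltrBlDl.
  - by rewrite /= ger0_norm ?subr_ge0 ?ltW // ltrBlDl.
  by apply: hno; exists (mkC x y); split => //; exact: h.
have : (area (I (complex.Re z) `*` I (complex.Im z)) <= area A)%E.
  by apply: le_measure => //; rewrite inE //; exact: measurableX.
have -> : area (I (complex.Re z) `*` I (complex.Im z)) = (d * d)%:E.
  by rewrite /area product_measure1E // EFinM; congr (_ * _)%E; exact: lI.
by rewrite A0 lee_fin leNgt mulr_gt0.
Qed.
Lemma sqr_sum_perturb (E eta a b a' b' : R) :
  0 <= a -> 0 <= b -> 0 <= a' -> 0 <= b' -> 0 <= eta ->
  a ^+ 2 + b ^+ 2 <= E -> a' <= a + eta -> b' <= b + eta ->
  a' ^+ 2 + b' ^+ 2 <= E + eta * (E + 2) + 2 * eta ^+ 2.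
Proof.
move=> a0 b0 a0' b0' e0 abE aa bb.
have hle (x x' : R) : 0 <= x' -> x' <= x + eta -> x' ^+ 2 <= (x + eta) ^+ 2.
  by move=> x0 xx; apply: lerXn2r; rewrite ?nnegrE // (le_trans x0).
apply: (le_trans (lerD (hle _ _ a0' aa) (hle _ _ b0' bb))).
(* This replaces the linear terms: [2a <= a^2 + 1], so [2 eta (a + b) <= eta (E + 2)]. *)
have h1 : 0 <= eta * ((a - 1) ^+ 2 + (b - 1) ^+ 2).
  by rewrite mulr_ge0 // addr_ge0 ?sqr_ge0.
have h2 : 0 <= eta * (E - (a ^+ 2 + b ^+ 2)) by rewrite mulr_ge0 // subr_ge0.
by lra.
Qed.

Lemma continuous_modulus (f : C -> C) (z : C) (eta : R) :
  {for z, continuous f} -> 0 < eta ->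
  exists2 e : R, 0 < e & forall w, modulus (w - z) < e -> modulus (f w - f z) <= eta.
Proof.
move=> /cvgrPdist_le cf eta0.
have eta0' : 0 < (eta%:C%C : C) by rewrite ltcR.
have /nbhs_ballP[e /= e0 he] := cf _ eta0'.
have eE : e = ((complex.Re e)%:C%C : C) by apply/esym/RRe_real/gtr0_real.
exists (complex.Re e) => [|w wz]; first by move: e0; rewrite eE ltcR.
have : ball z e w by rewrite -ball_normE /= distrC normE eE ltcR.
by move/he => /=; rewrite distrC normE lecR.
Qed.

(** Dividing the hypothesis by [al + be] gives [al + be <= K (al - be)]; then [2 (al^2 + be^2) = (al
    + be)^2 + (al - be)^2]. *)
Lemma dilatation_energy (K lam al be : R) :
  0 <= K -> 0 <= al -> 0 <= be -> `|al - be| <= lam ->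
  (al + be) ^+ 2 <= K * (al ^+ 2 - be ^+ 2) ->
  al ^+ 2 + be ^+ 2 <= (K ^+ 2 + 1) * lam ^+ 2 / 2.
Proof.
move=> K0 a0 b0 ll h.
have lam2 : (al - be) ^+ 2 <= lam ^+ 2.
  rewrite -[_ ^+ 2 in leLHS]real_normK ?num_real //.
  by apply: lerXn2r; rewrite ?nnegrE // (le_trans _ ll).
have h1 : al + be <= K * (al - be).
  (* The division fails only if [al = be = 0], where the claim is trivial. *)
  have [s0|s0] := eqVneq (al + be) 0.
    have -> : al = 0 by lra.
    have -> : be = 0 by lra.
    by rewrite subr0 mulr0 addr0.
  rewrite -(ler_pM2l (x := al + be)); last by rewrite lt_def s0 addr_ge0.
  by rewrite -expr2 (le_trans h) // le_eqVlt; apply/orP; left; apply/eqP; ring.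
have h2 : (al + be) ^+ 2 <= K ^+ 2 * (al - be) ^+ 2.
  rewrite -exprMn; apply: lerXn2r; rewrite ?nnegrE ?addr_ge0 //.
  by rewrite (le_trans _ h1) // addr_ge0.
have h3 : K ^+ 2 * (al - be) ^+ 2 <= K ^+ 2 * lam ^+ 2 by rewrite ler_wpM2l ?sqr_ge0.
by lra.
Qed.

(** The bound holds at points arbitrarily near [z], and continuity of the first derivatives carries
    it to [z]. *)
Lemma quasiregular_energy (K lam : R) (F : C -> C) :
  1 <= K -> quasiregular K F ->
  {in @unit_disc R, continuous (dx F)} -> {in @unit_disc R, continuous (dy F)} ->
  (forall z, unit_disc z -> lambda F z <= lam) ->
  forall z, unit_disc z ->
    modulus (dz F z) ^+ 2 + modulus (dzbar F z) ^+ 2 <= (K ^+ 2 + 1) * lam ^+ 2 / 2.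
Proof.
move=> K1 [_ _ _ _ hae] cx cy hlam z zD; set E := (X in _ <= X).
have E0 : 0 <= E by rewrite divr_ge0 // mulr_ge0 ?addr_ge0 ?sqr_ge0.
apply/ler_addgt0Pr => e e0.
(* [eta <= 1] gives [eta^2 <= eta], so the error [eta (E + 2) + 2 eta^2] is at most
   [eta (E + 4) <= e]. *)
pose eta := Num.min 1 (e / (E + 4)).
have E4 : 0 < E + 4 by rewrite (le_lt_trans E0) // ltrDl.
have eta0 : 0 < eta by rewrite lt_min ltr01 divr_gt0.
have zin : z \in @unit_disc R by rewrite inE.
have [d1 d10 hd1] := continuous_modulus (cx z zin) eta0.
have [d2 d20 hd2] := continuous_modulus (cy z zin) eta0.
have d0 : 0 < Num.min d1 d2 by rewrite lt_min d10.
have [w [wz wD hw]] :=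
  @ae_disc_dense (fun w => Lambda F w ^+ 2 <= K * Jac F w) z _ hae zD d0.
move: wz; rewrite lt_min => /andP[/hd1 hx /hd2 hy].
have half (u v : C) : modulus u <= eta -> modulus v <= eta ->
    modulus (2^-1 * (u + v)) <= eta.
  move=> hu hv; rewrite -(ler_pM2l (ltr0n R 2)) -[2 in leLHS](modulus_nat R) -modulusM.
  rewrite mulVKf ?pnatr_eq0 // (le_trans (modulusD _ _)) //.
  by rewrite mulr_natl mulr2n lerD.
have hz : modulus (dz F w - dz F z) <= eta.
  rewrite (_ : _ - _ = 2^-1 * ((dx F w - dx F z) + - mkC 0 1 * (dy F w - dy F z))).
    by apply: half => //; rewrite modulusM modulusN modulus_i mul1r.
  by rewrite /dz; ring.
have hzb : modulus (dzbar F w - dzbar F z) <= eta.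
  rewrite (_ : _ - _ = 2^-1 * ((dx F w - dx F z) + mkC 0 1 * (dy F w - dy F z))).
    by apply: half => //; rewrite modulusM modulus_i mul1r.
  by rewrite /dzbar; ring.
have Ew : modulus (dz F w) ^+ 2 + modulus (dzbar F w) ^+ 2 <= E.
  apply: dilatation_energy (hlam _ wD) hw; rewrite ?modulus_ge0 //.
  exact: le_trans K1.
have eta1 : eta <= 1 by rewrite ge_min lexx.
apply: (le_trans (sqr_sum_perturb _ _ _ _ _ Ew (modulus_le_dist hz) (modulus_le_dist hzb)));
  rewrite ?modulus_ge0 ?(ltW eta0) //.
have h1 : eta * (E + 4) <= e by rewrite -ler_pdivlMr // ge_min lexx orbT.
have h2 : eta ^+ 2 <= eta by rewrite expr2 ler_piMl ?(ltW eta0).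
by lra.
Qed.

End AlmostEverywhere.

(** * Fourier coefficients on circles and weighted coefficient sums *)

Section CoefficientBounds.
Variable R : realType.
Local Notation C := (Cplx R).

Lemma ler_geometric_limit (X E c t : R) (M0 : nat) :
  0 < t < 1 -> (forall M, (M0 <= M)%N -> X <= E + c * t ^+ M) -> X <= E.
Proof.
move=> /andP[t0 t1] h.
have cv : (fun M => E + c * t ^+ M) @ \oo --> E + c * 0.
  apply: cvgD; first exact: cvg_cst.
  by apply: cvgM; [exact: cvg_cst | apply: cvg_expr; rewrite gtr0_norm].
rewrite -[E]addr0 -(mulr0 c) -(cvg_lim _ cv) //.
apply: limr_ge; first exact: cvgP cv.
by near=> M; apply: h; near: M; exact: nbhs_infty_ge.
Unshelve. all: by end_near. Qed.

Lemma ler_expr_limit (X E : R) (D : nat) :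
  (forall r, 0 < r < 1 -> X * r ^+ D <= E) -> X <= E.
Proof.
move=> h.
have cv : (fun r : R => X * r ^+ D) @ 1^'- --> X * 1 ^+ D.
  apply: cvg_at_left_filter; apply: cvgM; first exact: cvg_cst.
  exact: exprn_continuous.
rewrite -[X]mulr1 -(expr1n R D) -(cvg_lim _ cv) //.
apply: limr_le; first exact: cvgP cv.
near=> r; apply: h; apply/andP; split.
  by near: r; apply: nbhs_left_gt.
by near: r; exact: nbhs_left_lt.
Unshelve. all: by end_near. Qed.

(** At [i = 0], where the predecessor is truncated, the factor [i] kills both sides. *)
Lemma mulr_expr_pred (z y : C) i :
  z * (i%:R * z ^+ i.-1 * y) = i%:R * z ^+ i * y.
Proof. by case: i => [|i]; rewrite ?mul0r ?mulr0 // exprS /=; ring. Qed.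

(* The coefficients of [z^n] and of [conj z^n] in [z * poly_dz] on [|z| = r].
   Conjugation exchanges [dz] and [dzbar], so those of [conj z * poly_dzbar]
   come from the same formula with [(conj b, conj a)] for [(a, b)]. *)
Definition fourier_dz p (a b : nat -> nat -> C) (r : R) (n : nat) : C * C :=
  (\sum_(1 <= k < p.+1) ((n + (k - 1))%:R * r ^+ (2 * (k - 1)))%:C%C * a n k,
   \sum_(1 <= k < p.+1) ((k - 1)%:R * r ^+ (2 * (k - 1)))%:C%C * (b n k)^*).

Lemma poly_dz_fourier p a b M (r : R) (z : C) : modulus z = r ->
  z * poly_dz p a b M z =
  \sum_(1 <= n < M) ((fourier_dz p a b r n).1 * z ^+ n +
                     (fourier_dz p a b r n).2 * z^* ^+ n).
Proof.
move=> zr; rewrite /poly_dz exchange_big mulr_sumr; apply: eq_bigr => n _ /=.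
rewrite mulr_sumr !mulr_suml -big_split; apply: eq_bigr => k _ /=.
have e (i : nat) (x y : C) : z * (x * (i%:R * z ^+ i.-1 * y)) =
    x * (i%:R * z ^+ i * y) by rewrite mulrCA mulr_expr_pred.
rewrite mulrDr !e exprM !rmorphM !rmorph_nat rmorphXn /=.
by rewrite -zr -mul_conj !exprD !exprMn; ring.
Qed.

Lemma poly_dzbar_fourier p a b M (r : R) (z : C) : modulus z = r ->
  z^* * poly_dzbar p a b M z =
  \sum_(1 <= n < M)
    ((fourier_dz p (fun n k => (b n k)^*) (fun n k => (a n k)^*) r n).2 * z ^+ n +
     (fourier_dz p (fun n k => (b n k)^*) (fun n k => (a n k)^*) r n).1 * z^* ^+ n).
Proof.
move=> zr; rewrite /poly_dzbar exchange_big mulr_sumr; apply: eq_bigr => n _ /=.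
rewrite mulr_sumr !mulr_suml -big_split; apply: eq_bigr => k _ /=.
have e (i : nat) (x y : C) : z^* * (x * (i%:R * y * z^* ^+ i.-1)) =
    x * (i%:R * z^* ^+ i * y).
  by rewrite mulrCA; congr (_ * _); rewrite mulrAC mulr_expr_pred.
rewrite mulrDr !e exprM !rmorphM !rmorph_nat rmorphXn /=.
by rewrite -zr -mul_conj conjCK !exprD !exprMn; ring.
Qed.

(** Nonnegative real factors keep the inner products nonnegative. *)
Lemma sum_sqr_modulus_scale_le (m n : nat) (c : nat -> R) (f : nat -> C) :
  (forall k, 0 <= c k) ->
  (forall i j, (m <= i < n)%N -> (m <= j < n)%N -> 0 <= complex.Re (f i * (f j)^*)) ->
  \sum_(m <= k < n) c k ^+ 2 * modulus (f k) ^+ 2 <=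
  modulus (\sum_(m <= k < n) (c k)%:C%C * f k) ^+ 2.
Proof.
move=> c0 h; rewrite !big_nat.
rewrite (eq_bigr (fun k => modulus ((c k)%:C%C * f k) ^+ 2)) => [|k _]; last first.
  by rewrite modulusM modulus_real ger0_norm // exprMn.
apply: sum_sqr_modulus_le => i j mi mj.
rewrite (_ : _ * _ = ((c i * c j)%:C%C : C) * (f i * (f j)^*)); last first.
  by rewrite !rmorphM /= [(_ (c j)%:C%C)]conjc_real; ring.
by rewrite ReM /= mul0r subr0 !mulr_ge0 // h.
Qed.

(** The family [a] enters the first component of [fourier_dz p a b] and, conjugated, the second
    component of [fourier_dz p b a]; hence the swap. *)
Lemma coefficient_energy p (a b : nat -> nat -> C) (r : R) n : 0 < r ->
  (forall k1 k2, (1 <= k1 <= p)%N -> (1 <= k2 <= p)%N ->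
     0 <= complex.Re (a n k1 * (a n k2)^*)) ->
  \sum_(1 <= k < p.+1) ((n + (k - 1))%:R ^+ 2 * modulus (a n k) ^+ 2 * r ^+ (4 * (k - 1)))
  <= modulus (fourier_dz p a b r n).1 ^+ 2 /\
  \sum_(1 <= k < p.+1) ((k - 1)%:R ^+ 2 * modulus (a n k) ^+ 2 * r ^+ (4 * (k - 1)))
  <= modulus (fourier_dz p b a r n).2 ^+ 2.
Proof.
move=> r0 h; split.
  apply: le_trans (sum_sqr_modulus_scale_le _ _) => [|k|//].
    rewrite le_eqVlt; apply/orP; left; apply/eqP; apply: eq_bigr => k _.
    by rewrite exprMn -exprM (_ : (2 * (k - 1) * 2 = 4 * (k - 1))%N); [ring|lia].
  by rewrite mulr_ge0 // exprn_ge0 // ltW.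
apply: le_trans (sum_sqr_modulus_scale_le _ _) => [|k|i j ip jp].
- rewrite le_eqVlt; apply/orP; left; apply/eqP; apply: eq_bigr => k _.
  rewrite modulus_conj exprMn -exprM (_ : (2 * (k - 1) * 2 = 4 * (k - 1))%N); [ring|lia].
- by rewrite mulr_ge0 // exprn_ge0 // ltW.
- by rewrite conjCK mulrC h.
Qed.

(** The squares of the factors that [z F_z] and [conj z F_zbar] put on [a n k], and in the opposite
    order on [b n k]. *)
Definition coef_weight (n k : nat) : R := (n + (k - 1))%:R ^+ 2 + (k - 1)%:R ^+ 2.

Definition weighted_energy (a b : nat -> nat -> C) n k : R :=
  coef_weight n k * (modulus (a n k) ^+ 2 + modulus (b n k) ^+ 2).

Lemma weighted_energy_ge0 a b n k : 0 <= weighted_energy a b n k.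
Proof. by rewrite mulr_ge0 // addr_ge0 // sqr_ge0. Qed.

(** * The coefficient energy of a mapping with pointwise bounded energy *)

Section Mapping.
Variables (p : nat) (a0 : C) (a b : nat -> nat -> C) (F : C -> C) (E : R).
Hypothesis hF : polyharmonic_series p a0 a b F.
Hypothesis dF : forall z, unit_disc z -> partially_derivable F z.
Hypothesis FE : forall z, unit_disc z ->
  modulus (dz F z) ^+ 2 + modulus (dzbar F z) ^+ 2 <= E.

(** Parseval is applied to the partial sums of length [M], whose derivatives are within [B t^M] of
    those of [F]; the first [M0] terms are kept while [M] tends to infinity. *)
Lemma circle_energy_le r M0 : 0 < r < 1 -> (0 < M0)%N ->
  \sum_(1 <= n < M0)
    (modulus (fourier_dz p a b r n).1 ^+ 2 + modulus (fourier_dz p a b r n).2 ^+ 2 +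
    (modulus (fourier_dz p (fun n k => (b n k)^*) (fun n k => (a n k)^*) r n).2 ^+ 2 +
     modulus (fourier_dz p (fun n k => (b n k)^*) (fun n k => (a n k)^*) r n).1 ^+ 2))
     * r ^+ (2 * n) <= E.
Proof.
move=> /andP[r0 r1] M00.
have r01 : 0 <= r < 1 by rewrite ltW.
have [B [t [B0 t01 hB]]] := poly_series_deriv hF dF r01.
have E0 : 0 <= E.
  have h0 : unit_disc (0 : C) by apply/unit_discE; rewrite modulus0.
  by apply: le_trans (FE h0); rewrite addr_ge0 ?sqr_ge0.
(* The error of [sqr_sum_perturb] at [eta = B t^M], with [t^(2M)] enlarged to [t^M]. *)
apply: (@ler_geometric_limit _ _ (B * (E + 2) + 2 * B ^+ 2) t M0) => // M M0M.
have M1 : (0 < M)%N by exact: leq_trans M0M.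
have /andP[t0 t1] := t01.
apply: (@le_trans _ _ (E + (B * t ^+ M) * (E + 2) + 2 * (B * t ^+ M) ^+ 2)); last first.
  have : t ^+ M * t ^+ M <= t ^+ M by rewrite ler_piMl ?exprn_ge0 ?exprn_ile1 ?ltW.
  move=> /(ler_wpM2l (sqr_ge0 B)); lra.
rewrite (le_trans _ (trig_parseval r0 (f := fun n => (fourier_dz p a b r n).1)
   (g := fun n => (fourier_dz p a b r n).2)
   (f' := fun n => (fourier_dz p (fun n k => (b n k)^*) (fun n k => (a n k)^*) r n).2)
   (g' := fun n => (fourier_dz p (fun n k => (b n k)^*) (fun n k => (a n k)^*) r n).1)
   (M := M) _)) //.
  rewrite (big_cat_nat M00 M0M) /= lerDl sumr_ge0 // => n _.
  by rewrite mulr_ge0 ?exprn_ge0 ?(ltW r0) // !addr_ge0 ?sqr_ge0.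
move=> z zr; rewrite -(poly_dz_fourier _ _ _ _ zr) -(poly_dzbar_fourier _ _ _ _ zr).
have zD : unit_disc z by apply/unit_discE; rewrite zr.
have zler : modulus z <= r by rewrite zr.
have [h1 h2] := hB M z M1 zler.
(* The factors [z] and [conj z] contribute [r^2 <= 1], which is dropped. *)
rewrite !modulusM modulus_conj zr !(exprMn 2 r) -mulrDr.
apply: (@le_trans _ _ (modulus (poly_dz p a b M z) ^+ 2 +
                       modulus (poly_dzbar p a b M z) ^+ 2)).
  by rewrite ler_piMl ?addr_ge0 ?sqr_ge0 // exprn_ile1 // ltW.
apply: (sqr_sum_perturb _ _ _ _ _ (FE zD) (modulus_le_dist h1) (modulus_le_dist h2));
  by rewrite ?modulus_ge0 // mulr_ge0 // exprn_ge0 // ltW.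
Qed.

Hypothesis acute_a : forall n k1 k2, (1 <= n)%N -> (1 <= k1 <= p)%N -> (1 <= k2 <= p)%N ->
  0 <= complex.Re (a n k1 * (a n k2)^*).
Hypothesis acute_b : forall n k1 k2, (1 <= n)%N -> (1 <= k1 <= p)%N -> (1 <= k2 <= p)%N ->
  0 <= complex.Re (b n k1 * (b n k2)^*).

Lemma sum_weighted_energy_le M0 : (0 < M0)%N ->
  \sum_(1 <= n < M0) \sum_(1 <= k < p.+1) weighted_energy a b n k <= E.
Proof.
(* This exponent exceeds every [4(k-1) + 2n] that occurs, so one power of [r] serves all terms as
   [r] tends to 1. *)
move=> M00; apply: (@ler_expr_limit _ _ (4 * p + 2 * M0)) => r r01.
apply: le_trans (circle_energy_le r01 M00); have /andP[r0 r1] := r01.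
rewrite mulr_suml !big_nat; apply: ler_sum => n /andP[n1 nM].
have [a1 a2] := coefficient_energy b r0 (fun k1 k2 => @acute_a n k1 k2 n1).
have [_ b2] := coefficient_energy a r0 (fun k1 k2 => @acute_b n k1 k2 n1).
have acute_conj (c : nat -> nat -> C) :
  (forall k1 k2, (1 <= k1 <= p)%N -> (1 <= k2 <= p)%N ->
     0 <= complex.Re (c n k1 * (c n k2)^*)) ->
  forall k1 k2, (1 <= k1 <= p)%N -> (1 <= k2 <= p)%N ->
     0 <= complex.Re ((c n k1)^* * ((c n k2)^*)^*).
  by move=> h k1 k2 hk1 hk2; rewrite conjCK mulrC h.
have [cb1 _] := coefficient_energy (a := fun n k => (b n k)^*) (fun n k => (a n k)^*) r0
  (acute_conj b (fun k1 k2 => @acute_b n k1 k2 n1)).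
have [_ ca2] := coefficient_energy (a := fun n k => (a n k)^*) (fun n k => (b n k)^*) r0
  (acute_conj a (fun k1 k2 => @acute_a n k1 k2 n1)).
apply: (le_trans _ (ler_wpM2r (exprn_ge0 (2 * n) (ltW r0))
  (lerD (lerD a1 b2) (lerD ca2 cb1)))).
rewrite -!big_split !mulr_suml /= !big_nat; apply: ler_sum => k /andP[k1 kp].
rewrite !modulus_conj [leRHS](_ : _ =
  weighted_energy a b n k * (r ^+ (4 * (k - 1)) * r ^+ (2 * n))).
  rewrite ler_wpM2l ?weighted_energy_ge0 // -exprD.
  by apply: ler_wiXn2l; rewrite ?(ltW r0) ?(ltW r1) //; lia.
by rewrite /weighted_energy /coef_weight; ring.
Qed.

(** A term with nonzero integer factor has degree [n + 2(k-1) - 1], which is positive unless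
    [n = k = 1]. *)
Lemma poly_dz0 M : (1 < M)%N -> (1 <= p)%N -> poly_dz p a b M 0 = a 1%N 1%N.
Proof.
move=> M1 p1; rewrite /poly_dz big_ltn ?ltnS // [X in _ + X]big_nat [X in _ + X]big1 ?addr0.
  rewrite big_ltn // [X in _ + X]big_nat [X in _ + X]big1 ?addr0.
    by rewrite subnn addn0 /= !expr0 !mulr1 !mul0r mulr0 addr0.
  move=> n /andP[n2 _]; rewrite subnn /= addn0 conjC0.
  case: n n2 => [|[|n]] // _.
  by rewrite /= exprS; ring.
move=> k /andP[k2 _]; rewrite big_nat big1 // => n /andP[n1 _].
rewrite conjC0; case: k k2 => [|[|k]] // _; rewrite !subn1 /= addnS !(exprS 0).
by ring.
Qed.

Lemma Jac0_coef : (1 <= p)%N -> Jac F 0 = 1 -> 1 <= modulus (a 1%N 1%N).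
Proof.
move=> p1 J0.
have [|B [t [B0 t01 hB]]] := poly_series_deriv hF dF (r := 0); first by rewrite lexx ltr01.
(* The sums run over [n < M], so the term [n = 1] is present only from [M = 2] on. *)
apply: (@ler_geometric_limit _ _ B t 2) => // M M2.
have [||h _] := hB M 0; rewrite ?modulus0 //; first exact: leq_trans M2.
rewrite poly_dz0 // in h.
have dz1 : 1 <= modulus (dz F 0).
  rewrite -(ler_pXn2r (n := 2)) ?nnegrE ?modulus_ge0 // expr1n -J0 /Jac.
  by rewrite gerBl sqr_ge0.
apply: (le_trans dz1); rewrite -[dz F 0](subrK (a 1%N 1%N)).
by rewrite (le_trans (modulusD _ _)) // addrC lerD2l.
Qed.

Lemma weighted_energy_coef_le n k :
  (1 <= p)%N -> Jac F 0 = 1 -> (1 <= n)%N -> (1 <= k <= p)%N ->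
  (n != 1%N) || (k != 1%N) -> 1 + weighted_energy a b n k <= E.
Proof.
move=> p1 J0 n1 /andP[k1 kp] nk.
have we0 := weighted_energy_ge0 a b.
have term (f : nat -> R) i j1 j2 : (forall i, 0 <= f i) -> (j1 <= i < j2)%N ->
    f i <= \sum_(j1 <= j < j2) f j.
  move=> f0 ij; rewrite (bigD1_seq i) ?iota_uniq ?mem_index_iota //=.
  by rewrite lerDl sumr_ge0.
have e11 : 1 <= weighted_energy a b 1 1.
  rewrite /weighted_energy /coef_weight subnn addn0 expr0n addr0 expr1n mul1r.
  by rewrite ler_wpDr ?sqr_ge0 // exprn_ege1 // Jac0_coef.
apply: (le_trans _ (sum_weighted_energy_le (ltn0Sn n))).
(* For [n = 1] the terms [(1, 1)] and [(1, k)] share a row; otherwise they come from different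
   rows. *)
have [n1' | n1'] := eqVneq n 1%N.
  rewrite n1' eqxx /= in nk *; rewrite big_nat1 big_ltn ?ltnS // lerD //.
  by apply: term => [i|]; [exact: we0 | lia].
rewrite big_ltn ?ltnS //; apply: lerD.
  rewrite (le_trans e11) //.
  by apply: (term (weighted_energy a b 1)) => [i|]; [exact: we0 | lia].
apply: (@le_trans _ _ (\sum_(1 <= k < p.+1) weighted_energy a b n k)).
  by apply: (term (weighted_energy a b n)) => [i|]; [exact: we0 | lia].
apply: (term (fun n => \sum_(1 <= k < p.+1) weighted_energy a b n k)) => [i|].
  by apply: sumr_ge0.
by lia.
Qed.

End Mapping.

End CoefficientBounds.

(** * Deduction of the three coefficient estimates *)

Theorem corollary2p3 (R : realType) (K lam : R) (p : nat) (a0 : Cplx R)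
    (a b : nat -> nat -> Cplx R) (F : Cplx R -> Cplx R)
    (hK : 1 <= K) (hp : (1 <= p)%N)
    (hqr : quasiregular K F)
    (hpoly : polyharmonic p F)
    (hF : polyharmonic_series p a0 a b F)
    (harg_a : forall n k1 k2 : nat, (1 <= n)%N ->
       (1 <= k1 <= p)%N -> (1 <= k2 <= p)%N ->
       a n k1 != 0 -> a n k2 != 0 -> `|parg (a n k1 / a n k2)| <= pi / 2)
    (harg_b : forall n k3 k4 : nat, (1 <= n)%N ->
       (1 <= k3 <= p)%N -> (1 <= k4 <= p)%N ->
       b n k3 != 0 -> b n k4 != 0 -> `|parg (b n k3 / b n k4)| <= pi / 2)
    (hlam : forall z : Cplx R, unit_disc z -> lambda F z <= lam)
    (hF0 : F 0 = 0) (hJ0 : Jac F 0 = 1) :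
  [/\ forall n : nat, (2 <= n)%N ->
        modulus (a n 1%N) + modulus (b n 1%N) <=
          Num.sqrt ((K ^+ 2 + 1) * lam ^+ 2 - 1 / K) / n%:R,
      forall n k : nat, (2 <= n)%N -> (2 <= k <= p)%N ->
        modulus (a n k) + modulus (b n k) <=
          Num.sqrt ((K ^+ 2 + 1) * lam ^+ 2 - 1 / K) / Num.sqrt 10 &
      forall k : nat, (2 <= k <= p)%N ->
        modulus (a 1%N k) + modulus (b 1%N k) <=
          Num.sqrt ((K ^+ 2 + 1) * lam ^+ 2 - 1 / K) / Num.sqrt 5].
Proof.
have acute (c : nat -> nat -> Cplx R) : (forall n k1 k2 : nat, (1 <= n)%N ->
      (1 <= k1 <= p)%N -> (1 <= k2 <= p)%N ->
      c n k1 != 0 -> c n k2 != 0 -> `|parg (c n k1 / c n k2)| <= pi / 2) ->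
    forall n k1 k2, (1 <= n)%N -> (1 <= k1 <= p)%N -> (1 <= k2 <= p)%N ->
      0 <= complex.Re (c n k1 * (c n k2)^*).
  move=> h n k1 k2 n1 hk1 hk2.
  have [->|c1] := eqVneq (c n k1) 0; first by rewrite mul0r.
  have [->|c2] := eqVneq (c n k2) 0; first by rewrite conjC0 mulr0.
  by apply: parg_le_pihalf_Re => //; exact: h.
have [dF cx cy] : [/\ forall z, unit_disc z -> partially_derivable F z,
    {in @unit_disc R, continuous (dx F)} & {in @unit_disc R, continuous (dy F)}].
  (* As [p >= 1], [F] is at least twice continuously differentiable. *)
  case: hpoly => + _; case: (p) hp => // q _; rewrite mulnS /= => -[_ [dF cx cy]].
  by split=> //; [case: cx | case: cy].
have FE := quasiregular_energy hK hqr cx cy hlam.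
have energy := weighted_energy_coef_le hF dF FE (acute a harg_a) (acute b harg_b) hp hJ0.
(* All three estimates are this one with different [d]. Since [(A + B)^2 <= 2 (A^2 + B^2)], doubling
   the energy bound gives [(K^2 + 1) lam^2 - 2], and [1 / K <= 1 <= 2] weakens this to the stated
   radicand. *)
have bound n k (d : R) : (1 <= n)%N -> (1 <= k <= p)%N -> (n != 1%N) || (k != 1%N) ->
    0 < d -> d ^+ 2 <= coef_weight R n k ->
    modulus (a n k) + modulus (b n k) <=
      Num.sqrt ((K ^+ 2 + 1) * lam ^+ 2 - 1 / K) / d.
  move=> n1 kp nk d0 dw; have := energy n k n1 kp nk; rewrite /weighted_energy.
  set A := modulus (a n k); set B := modulus (b n k); set w := coef_weight R n k => h.
  have AB0 : 0 <= A + B by rewrite addr_ge0 ?modulus_ge0.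
  rewrite ler_pdivlMr // -[leLHS]ger0_norm ?mulr_ge0 ?(ltW d0) // -sqrtr_sqr.
  apply: ler_wsqrtr; rewrite exprMn.
  have invK : 1 / K <= 1 by rewrite ler_pdivrMr ?mul1r // (lt_le_trans ltr01).
  have h1 : (A + B) ^+ 2 <= 2 * (A ^+ 2 + B ^+ 2).
    by rewrite -subr_ge0 (_ : _ - _ = (A - B) ^+ 2) ?sqr_ge0 //; ring.
  have h2 : (A + B) ^+ 2 * d ^+ 2 <= 2 * (A ^+ 2 + B ^+ 2) * w.
    by rewrite ler_pM ?sqr_ge0.
  by lra.
have natS m : (m%:R : R) ^+ 2 = (m ^ 2)%:R by rewrite natrX.
split.
(* For [k = 1] the weight is exactly [n^2]. *)
- move=> n n2; apply: bound; rewrite ?ltr0n //; try lia.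
  by rewrite /coef_weight subnn addn0 expr0n addr0.
(* The weight is smallest at [n = k = 2], where it is [3^2 + 1^2 = 10]. *)
- move=> n k n2 /andP[k2 kp]; apply: bound; rewrite ?sqrtr_gt0 //; try lia.
  by rewrite sqr_sqrtr // /coef_weight !natS -natrD ler_nat; nia.
(* With [n = 1] the weight is smallest at [k = 2], where it is [2^2 + 1^2 = 5]. *)
- move=> k /andP[k2 kp]; apply: bound; rewrite ?sqrtr_gt0 //; try lia.
  by rewrite sqr_sqrtr // /coef_weight !natS -natrD ler_nat; nia.
Qed.
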